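(* Let $d\ge 1$ and consider the modulation system (given in the context) for $(A,k,B,X,\beta,\gamma)$, with $L=e^{2k}>0$, $\frac{\mathrm{d}s}{\mathrm{d}t}=L^{-2}$, $s(0)=0$, and Hamiltonian $$\mathcal H(k,B,X,\beta)=e^{-4k}\Big(\frac{B^2}{4}+1\Big)+e^{4k}+|X|^2+|\beta|^2 .$$ There exists a symplectic change of variables $(X,B,k,\beta)\mapsto(h,a,\xi,\theta)$, with $h\in\mathbb R$, $a\in\mathbb R^d$, and angles $\xi\in[0,2\pi]$, $\theta\in[0,2\pi]^d$ (understood modulo $2\pi$), defined away from the degenerate set where $X_i=\beta_i=0$ for some $i$ or $(L,B)=(1,0)$, such that the Hamiltonian in these variables is $$E(h,a,\xi,\theta)=4h+2\sum_{i=1}^d a_i,$$ so that the flow in the variables $(h,a,\xi,\theta)$ is given by $$a(t)=a(0),\qquad \theta_i(t)=\theta_i(0)+2t\ (i=1,\dots,d),\qquad h(t)=h(0),\qquad \xi(t)=\xi(0)-4t .$$ Moreover the solution of the modulation system is given by the explicit formulae (at degenerate data, with arbitrary values of the undefined angles at time $0$) $$\begin{aligned} A(t)&=A(0)\Big(\frac{L(t)}{L(0)}\Big)^{\frac{2-d}{2}},\\ e^{4k(t)}&=L(t)^2=2h(t)-\cos(\xi(t))\sqrt{4h(t)^2-1},\\ B(t)&=2\sin(\xi(t))\sqrt{4h(t)^2-1},\\ X_i(t)&=\sin(\theta_i(t))\sqrt{2a_i(t)},\quad i=1,\dots,d,\\ \beta_i(t)&=\cos(\theta_i(t))\sqrt{2a_i(t)},\quad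 i=1,\dots,d,\\ \gamma(t)&=\gamma(0)+\sum_{l=1}^d\frac{a_l(0)}{2}\big[\sin(2\theta_l(t))-\sin(2\theta_l(0))\big],\\ s(t)&=-\frac12\arctan\Big(\big(2h(0)+\sqrt{4h(0)^2-1}\big)\tan\big(\tfrac{\xi(0)}{2}-2t\big)\Big)\\ &\quad+\frac12\arctan\Big(\big(2h(0)+\sqrt{4h(0)^2-1}\big)\tan\big(\tfrac{\xi(0)}{2}\big)\Big)+m_t\frac{\pi}{2}, \end{aligned}$$ where, if $m_0\in\mathbb Z$ is such that $\frac{\xi(0)}{2}\in m_0\pi+\left(-\frac{\pi}{2},\frac{\pi}{2}\right]$, then $m_t\in\mathbb Z$ is defined by $\frac{\xi(t)}{2}\in(m_0-m_t)\pi+\left(-\frac{\pi}{2},\frac{\pi}{2}\right]$.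
   Context: The unknowns are functions of $t$: $A,B,\gamma\in\mathbb R$, $L>0$, $X,\beta\in\mathbb R^d$, with $k=\frac12\log L$. $|\cdot|$ is the Euclidean norm. The modulation system is $$A_t=\frac{AB}{2L^2}(d-2),\quad L_t=-\frac{B}{L},\quad B_t=-\frac{4}{L^2}+4L^2-\frac{B^2}{L^2},\quad X_t=2\beta,\quad \beta_t=-2X,\quad \gamma_t=|\beta|^2-|X|^2,$$ which is equivalent, with $L=e^{2k}$, to $$k_t=-\partial_B\mathcal H,\quad B_t=\partial_k\mathcal H,\quad X_t=\nabla_\beta\mathcal H,\quad \beta_t=-\nabla_X\mathcal H,\quad A_t=\frac{AB}{2}(d-2)e^{-4k},\quad \gamma_t=|\beta|^2-|X|^2 .$$ Subscript $t$ denotes the time derivative. ''Symplectic'' is with respect to the form of this Hamiltonian system, i.e. $\mathrm dB\wedge\mathrm dk+\sum_i\mathrm dX_i\wedge\mathrm d\beta_i=\mathrm dh\wedge\mathrm d\xi+\sum_i\mathrm d\theta_i\wedge\mathrm da_i$. In the formulae as functions of time, $\xi(t)$ and $\theta_i(t)$ are real-valued (not reduced modulo $2\pi$). Convention: for $c>0$ and $m\in\mathbb Z$, $\arctan\big(c\tan(\frac\pi2+m\pi)\big)$ is understood to be $\frac\pi2$. *)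

(* Defs.v *)
From HB Require Import structures.
From mathcomp Require Import all_boot all_order all_algebra.
From mathcomp Require Import all_classical all_reals all_analysis.
Set Implicit Arguments.
Unset Strict Implicit.
Unset Printing Implicit Defensive.
Import Order.TTheory GRing.Theory Num.Theory.
Import numFieldNormedType.Exports.
Local Open Scope classical_set_scope.
Local Open Scope ring_scope.

(* Points of the phase space are tuples (X, B, k, beta); points of the space
   of new variables are tuples (h, a, xi, theta), with real-valued angles. Both
   are products of normed modules, so that the library's differential ['d f p]
   applies to maps between them. *)
Definition phase (R : realType) (d : nat) := ('rV[R]_d * R * R * 'rV[R]_d)%type.
Definition actang (R : realType) (d : nat) := (R * 'rV[R]_d * R * 'rV[R]_d)%type.

Section Coordinates.
Context {R : realType} {d : nat}.
Implicit Types (p : phase R d) (q : actang R d).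

Definition pX p : 'rV[R]_d := p.1.1.1.
Definition pB p : R := p.1.1.2.
Definition pk p : R := p.1.2.
Definition pbeta p : 'rV[R]_d := p.2.
Definition pL p : R := expR (2 * pk p).

Definition qh q : R := q.1.1.1.
Definition qa q : 'rV[R]_d := q.1.1.2.
Definition qxi q : R := q.1.2.
Definition qtheta q : 'rV[R]_d := q.2.

End Coordinates.

(* The square of the Euclidean norm (the library's norm on ['rV_d] is the sup
   norm). *)
Definition sqnorm2 {R : realType} {d : nat} (v : 'rV[R]_d) : R :=
  \sum_(i < d) v 0 i ^+ 2.

Definition hamiltonian {R : realType} {d : nat} (p : phase R d) : R :=
  expR (- (4 * pk p)) * (pB p ^+ 2 / 4 + 1) + expR (4 * pk p)
  + sqnorm2 (pX p) + sqnorm2 (pbeta p).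

Definition new_hamiltonian {R : realType} {d : nat} (q : actang R d) : R :=
  4 * qh q + 2 * \sum_(i < d) qa q 0 i.

(* dB /\ dk + sum_i dX_i /\ dbeta_i *)
Definition omega_phase {R : realType} {d : nat} (u v : phase R d) : R :=
  (pB u * pk v - pk u * pB v)
  + \sum_(i < d) (pX u 0 i * pbeta v 0 i - pbeta u 0 i * pX v 0 i).

(* dh /\ dxi + sum_i dtheta_i /\ da_i *)
Definition omega_actang {R : realType} {d : nat} (u v : actang R d) : R :=
  (qh u * qxi v - qxi u * qh v)
  + \sum_(i < d) (qtheta u 0 i * qa v 0 i - qa u 0 i * qtheta v 0 i).

Definition degenerate_hB {R : realType} {d : nat} (p : phase R d) : Prop :=
  pL p = 1 /\ pB p = 0.

Definition degenerate_at {R : realType} {d : nat} (p : phase R d) (i : 'I_d) : Prop :=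
  pX p 0 i = 0 /\ pbeta p 0 i = 0.

Definition nondegenerate_set {R : realType} {d : nat} : set (phase R d) :=
  [set p | ~ ((exists i, degenerate_at p i) \/ degenerate_hB p)].

Definition eqmod2pi {R : realType} (x y : R) : Prop :=
  exists m : int, x = y + m%:~R * (2 * pi).

Definition eqangles {R : realType} {d : nat} (q q' : actang R d) : Prop :=
  [/\ qh q = qh q', qa q = qa q', eqmod2pi (qxi q) (qxi q') &
      forall i, eqmod2pi (qtheta q 0 i) (qtheta q' 0 i)].

(* [f] is of class C^n on [U], resp. smooth on [U], where [U] is meant to be
   open. *)
Fixpoint classC {R : realType} {V W : normedModType R} (n : nat) (U : set V)
    (f : V -> W) : Prop :=
  match n with
  | 0 => forall p, U p -> {for p, continuous f}
  | m.+1 => (forall p, U p -> differentiable f p) /\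
            (forall v : V, classC m U (fun p => 'd f p v))
  end.

Definition smooth_on {R : realType} {V W : normedModType R} (U : set V)
    (f : V -> W) : Prop :=
  forall n, classC n U f.

(* [Phi] induces a symplectic diffeomorphism from the open set [U] onto an open
   subset of R x R^d x (R/2piZ) x (R/2piZ)^d. A representative in [0, 2pi] of
   an angle cannot be continuous, so regularity is that of local lifts of [Phi]
   to real-valued angles; the inverse [G] is defined on all real angles. *)
Definition symplectic_change {R : realType} {d : nat} (U : set (phase R d))
    (Phi : phase R d -> actang R d) : Prop :=
  [/\ open U,
      forall p, U p -> 0 <= qxi (Phi p) <= 2 * pi /\
        (forall i, 0 <= qtheta (Phi p) 0 i <= 2 * pi),
      forall p, U p -> exists (N : set (phase R d)) (F : phase R d -> actang R d),
        [/\ open N /\ N p, smooth_on N F,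
            forall r, N r -> eqangles (F r) (Phi r) &
            forall u v, omega_actang ('d F p u) ('d F p v) = omega_phase u v] &
      let V := [set q | exists2 p, U p & eqangles q (Phi p)] in
      open V /\
      exists G : actang R d -> phase R d,
        smooth_on V G /\
        (forall p q, U p -> eqangles q (Phi p) -> G q = p)].

(* [q] is a value of the coordinates [Phi] at [p], with real-valued angles; an
   angle that is undefined at [p] may take any value. *)
Definition coordinates_of {R : realType} {d : nat} (Phi : phase R d -> actang R d)
    (p : phase R d) (q : actang R d) : Prop :=
  [/\ qh q = qh (Phi p), qa q = qa (Phi p),
      ~ degenerate_hB p -> eqmod2pi (qxi q) (qxi (Phi p)) &
      forall i, ~ degenerate_at p i ->
        eqmod2pi (qtheta q 0 i) (qtheta (Phi p) 0 i)].

(* The evolution at time [t] in the new variables. *)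
Definition flow_actang {R : realType} {d : nat} (q : actang R d) (t : R) :
    actang R d :=
  (qh q, qa q, qxi q - 4 * t, \row_(i < d) (qtheta q 0 i + 2 * t)).

(* The modulation system on the open interval [J], together with the rescaled
   time [s]. The unknown [L > 0] is represented by k = (log L) / 2. *)
Record modulation_solution {R : realType} {d : nat} (J : set R)
    (A k B : R -> R) (X beta : R -> 'rV[R]_d) (gamma s : R -> R) : Prop := {
  eq_A : forall t, J t -> is_derive t (1 : R) A
    (A t * B t / (2 * expR (2 * k t) ^+ 2) * (d%:R - 2));
  eq_L : forall t, J t -> is_derive t (1 : R) (fun u => expR (2 * k u))
    (- (B t / expR (2 * k t)));
  eq_B : forall t, J t -> is_derive t (1 : R) B
    (- (4 / expR (2 * k t) ^+ 2) + 4 * expR (2 * k t) ^+ 2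
     - B t ^+ 2 / expR (2 * k t) ^+ 2);
  eq_X : forall t, J t -> is_derive t (1 : R) X (2 *: beta t);
  eq_beta : forall t, J t -> is_derive t (1 : R) beta (- (2 *: X t));
  eq_gamma : forall t, J t -> is_derive t (1 : R) gamma
    (sqnorm2 (beta t) - sqnorm2 (X t));
  eq_s : forall t, J t -> is_derive t (1 : R) s (expR (2 * k t) ^+ 2)^-1;
  init_s : s 0 = 0
}.

(* arctan (c tan y), with value pi/2 at the poles of tan. *)
Definition atan_tan {R : realType} (c y : R) : R :=
  if cos y == 0 then pi / 2 else atan (c * tan y).

(* y is in m pi + (-pi/2, pi/2] *)
Definition in_branch {R : realType} (y : R) (m : int) : Prop :=
  m%:~R * pi - pi / 2 < y <= m%:~R * pi + pi / 2.

Record explicit_formulae {R : realType} {d : nat} (q : actang R d) (t : R)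
    (A k B : R -> R) (X beta : R -> 'rV[R]_d) (gamma s : R -> R) : Prop := {
  (* the arguments of the square roots below are nonnegative *)
  fml_dom : 0 <= 4 * qh q ^+ 2 - 1 /\ forall i, 0 <= 2 * qa q 0 i;
  fml_A : A t = A 0 * (expR (2 * k t) / expR (2 * k 0)) `^ ((2 - d%:R) / 2);
  fml_L : expR (4 * k t) = expR (2 * k t) ^+ 2 /\
    expR (2 * k t) ^+ 2 =
      2 * qh (flow_actang q t)
      - cos (qxi (flow_actang q t))
        * Num.sqrt (4 * qh (flow_actang q t) ^+ 2 - 1);
  fml_B : B t = 2 * sin (qxi (flow_actang q t))
    * Num.sqrt (4 * qh (flow_actang q t) ^+ 2 - 1);
  fml_X : forall i, X t 0 i =
    sin (qtheta (flow_actang q t) 0 i)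
    * Num.sqrt (2 * qa (flow_actang q t) 0 i);
  fml_beta : forall i, beta t 0 i =
    cos (qtheta (flow_actang q t) 0 i)
    * Num.sqrt (2 * qa (flow_actang q t) 0 i);
  fml_gamma : gamma t = gamma 0 + \sum_(l < d) qa q 0 l / 2 *
    (sin (2 * qtheta (flow_actang q t) 0 l) - sin (2 * qtheta q 0 l));
  fml_s : forall m0 mt : int,
    in_branch (qxi q / 2) m0 ->
    in_branch (qxi (flow_actang q t) / 2) (m0 - mt) ->
    let c := 2 * qh q + Num.sqrt (4 * qh q ^+ 2 - 1) in
    s t = - (1 / 2) * atan_tan c (qxi q / 2 - 2 * t)
          + 1 / 2 * atan_tan c (qxi q / 2) + mt%:~R * (pi / 2)
}.

(* Main.v *)
(* Write r = sqrt (4 h^2 - 1). The angles are the polar angles of the planar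
   vectors (2 h - L^2, B / 2), of length r, and (beta_i, X_i), of length
   sqrt (2 a_i). Since h and the a_i are conserved, these vectors solve linear
   equations of constant rotation along any solution, which yields uniqueness
   and the explicit formulae at once, also at degenerate points, where a vector
   vanishes and its angle is irrelevant.

   An angle has the smooth local lift alpha + atan (s' / c'), where (c', s') is
   the vector rotated by - alpha. All maps to be differentiated are thus
   elementary expressions; these are closed under differentiation, so their
   differentiability already gives smoothness, and differentials are computed
   symbolically. *)

Require Import Defs.
From HB Require Import structures.
From mathcomp Require Import all_boot all_order all_algebra.
From mathcomp Require Import all_classical all_reals all_analysis.
From mathcomp Require Import ring lra.
Set Implicit Arguments.
Unset Strict Implicit.
Unset Printing Implicit Defensive.
Import Order.TTheory GRing.Theory Num.Theory.
Import numFieldNormedType.Exports.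
Local Open Scope classical_set_scope.
Local Open Scope ring_scope.

(** * Elementary expressions and their differentials *)

(** Origin of the vector (2 h - L^2, B / 2): with l = L^2 = e^{4k}, the part of the Hamiltonian in
    (k, B) is 4 h, and multiplying it by l gives 4 h l = B^2 / 4 + 1 + l^2, that is (l - 2 h)^2 + (B
    / 2)^2 = 4 h^2 - 1. The level sets of h are thus circles in the plane (l, B / 2), reduced to a
    point exactly when h = 1 / 2, at (L, B) = (1, 0). All these circles are traversed with the same
    angular speed 4, those of (beta_i, X_i) with speed 2. As the frequency does not depend on the
    energy, the action is the energy divided by it, whence the terms 4 h and 2 a_i of E. The time s
    is the integral of 1 / (2 h - r cos xi). Its usual primitive, an arctangent of a multiple of tan
    (xi / 2), jumps at the poles of the tangent, so the differentiation is done on a continuous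
    branch and the integer m_t only enters when this branch is compared with the arctangent. *)

Section Differentials.
Context {R : realType} {V W : normedModType R}.
Implicit Types (f : V -> R) (p v : V).

(** A differential depends only on the germ. In [classC] the iterated differentials are bare
    functions, known to agree with an expression only on the open set [U]; this lemma carries the
    derivative over to them. *)
Lemma is_diff_near (F G : V -> W) (dF : V -> W) p :
  (\forall x \near p, F x = G x) -> is_diff p F dF -> is_diff p G dF.
Proof.
move=> FG Fp.
have Fdiff : differentiable F p by exact: ex_diff.
have FGp : F p = G p by exact: nbhs_singleton FG.
have exp : G \o shift p = cst (G p) + ('d F p : V -> W) +o_ 0 id.
  apply/eqaddoP => e e0.
  have /diff_locally /eqaddoP /(_ e e0) := Fdiff.
  have FG0 : \forall x \near 0, F (x + p) = G (x + p).
    move: FG; rewrite (near_shift 0).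
    by apply: filterS => x /=; rewrite subr0.
  apply: filterS2 FG0 => x Fx.
  rewrite /= -![(_ - _ : _ -> _) _]/(_ - _) -![(_ + _ : _ -> _) _]/(_ + _) /=.
  by rewrite /cst Fx FGp.
have dG : 'd G p = 'd F p :> (V -> W).
  by apply: diff_unique => //; exact: diff_continuous.
apply: DiffDef; last by rewrite dG diff_val.
by apply/diff_locallyP; split; rewrite dG //; exact: diff_continuous.
Qed.

Lemma is_diff_comp_real (g : R -> R) (a : R) f df p :
  is_derive (f p) (1 : R) g a -> is_diff p f df ->
  is_diff p (fun x => g (f x)) (fun v => df v * a).
Proof.
move=> ga fp.
have gd : differentiable g (f p) by apply/derivable1_diffP; exact: ex_derive.
have gdiff : is_diff (f p) g (fun h => h *: a).
  apply: DiffDef => //; rewrite diff1E // funeqE => h.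
  by rewrite derive1E derive_val.
exact: (@is_diff_comp _ _ _ _ f df g (fun h => h *: a) p).
Qed.

End Differentials.

(** [Coord] takes an arbitrary function; that it is linear and continuous is left to [defined], so
    the syntax needs no structure on [V]. *)
Inductive expr (R : realType) (V : Type) : Type :=
| Coord of (V -> R)
| Const of R
| Add of expr R V & expr R V
| Mul of expr R V & expr R V
| Inv of expr R V
| Exp of expr R V
| Ln of expr R V
| Sqrt of expr R V
| Sin of expr R V
| Cos of expr R V
| Atan of expr R V.
Arguments Const {R V}.

Fixpoint eval {R : realType} {V : Type} (e : expr R V) (p : V) : R :=
  match e with
  | Coord l => l p
  | Const a => a
  | Add a b => eval a p + eval b p
  | Mul a b => eval a p * eval b p
  | Inv a => (eval a p)^-1
  | Exp a => expR (eval a p)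
  | Ln a => ln (eval a p)
  | Sqrt a => Num.sqrt (eval a p)
  | Sin a => sin (eval a p)
  | Cos a => cos (eval a p)
  | Atan a => atan (eval a p)
  end.

(** The direction [v] is fixed, so the result is again a scalar expression in the same point.
    Factors are ordered as in [is_diffM] and [is_diff_comp_real], so that these rules apply directly
    in [is_diff_eval]. *)
Fixpoint deriv_at {R : realType} {V : Type} (v : V) (e : expr R V) : expr R V :=
  match e with
  | Coord l => Const (l v)
  | Const a => Const 0
  | Add a b => Add (deriv_at v a) (deriv_at v b)
  | Mul a b => Add (Mul a (deriv_at v b)) (Mul b (deriv_at v a))
  | Inv a => Mul (deriv_at v a) (Mul (Const (-1)) (Inv (Mul a a)))
  | Exp a => Mul (deriv_at v a) (Exp a)
  | Ln a => Mul (deriv_at v a) (Inv a)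
  | Sqrt a => Mul (deriv_at v a) (Inv (Mul (Const 2) (Sqrt a)))
  | Sin a => Mul (deriv_at v a) (Cos a)
  | Cos a => Mul (deriv_at v a) (Mul (Const (-1)) (Sin a))
  | Atan a => Mul (deriv_at v a) (Inv (Add (Const 1) (Mul a a)))
  end.

Section Expressions.
Context {R : realType} {V : normedModType R}.
Implicit Types (e : expr R V) (p v : V).

(* Linear and continuous, without naming the linear structure. *)
Definition is_coord (l : V -> R) : Prop := forall q, is_diff q l l.

(** Differentiability at [p] is meant, not mere meaningfulness: [Sqrt] demands a positive argument.
    By [defined_deriv] the conditions pass to all derivatives. *)
Fixpoint defined e p : Prop :=
  match e with
  | Coord l => is_coord l
  | Const a => True
  | Add a b | Mul a b => defined a p /\ defined b p
  | Inv a => defined a p /\ eval a p != 0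
  | Exp a | Sin a | Cos a | Atan a => defined a p
  | Ln a | Sqrt a => defined a p /\ 0 < eval a p
  end.

Lemma defined_deriv e v p : defined e p -> defined (deriv_at v e) p.
Proof.
elim: e => //=.
- by move=> a iha b ihb [/[dup] ? /iha ? /[dup] ? /ihb ?].
- by move=> a iha b ihb [/[dup] ? /iha ? /[dup] ? /ihb ?].
- by move=> a iha [/[dup] ? /iha ? a0]; rewrite mulf_neq0.
- by move=> a iha /[dup] ? /iha ?.
- by move=> a iha [/[dup] ? /iha ? a0]; rewrite gt_eqF.
- move=> a iha [/[dup] ? /iha ? a0].
  by rewrite mulf_neq0 // ?pnatr_eq0 // gt_eqF // sqrtr_gt0.
- by move=> a iha /[dup] ? /iha ?.
- by move=> a iha /[dup] ? /iha ?.
- move=> a iha /[dup] ? /iha ?; do !split => //.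
  by rewrite gt_eqF // ltr_pwDl // -expr2 sqr_ge0.
Qed.

Lemma is_diff_eval e p :
  defined e p -> is_diff p (eval e) (fun v => eval (deriv_at v e) p).
Proof.
elim: e => /=.
- by move=> l lp; exact: lp.
- by move=> a _; exact: is_diff_cst.
- move=> a iha b ihb [/iha {}iha /ihb {}ihb].
  exact: (is_diffD iha ihb).
- move=> a iha b ihb [/iha {}iha /ihb {}ihb].
  exact: (is_diffM iha ihb).
- move=> a iha [/iha {}iha a0].
  have ga : is_derive (eval a p) (1 : R) GRing.inv
      (-1 * (eval a p * eval a p)^-1).
    have /= := is_deriveV a0 (is_derive_id (eval a p) (1 : R)).
    by move/is_derive_eq; apply; rewrite /GRing.scale /= mulr1 mulN1r expr2.
  exact: (is_diff_comp_real ga iha).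
- by move=> a iha /iha {}iha; exact: is_diff_comp_real.
- move=> a iha [/iha {}iha a0]; apply: is_diff_comp_real.
  exact: is_derive1_ln.
- move=> a iha [/iha {}iha a0]; apply: is_diff_comp_real.
  exact: is_derive1_sqrt.
- by move=> a iha /iha {}iha; exact: is_diff_comp_real.
- move=> a iha /iha {}iha; apply: is_diff_comp_real.
  by rewrite mulN1r; exact: is_derive_cos.
- move=> a iha /iha {}iha; exact: is_diff_comp_real.
Qed.

Lemma is_derive_eval (c : R -> V) dc t e :
  is_derive t (1 : R) c dc -> defined e (c t) ->
  is_derive t (1 : R) (fun u => eval e (c u)) (eval (deriv_at dc e) (c t)).
Proof.
move=> ct ect; have [ed eE] := is_diff_eval ect.
have cd : differentiable c t by apply/derivable1_diffP; exact: ex_derive.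
apply: DeriveDef.
  by apply/derivable1_diffP; exact: (differentiable_comp cd ed).
rewrite deriveE; last exact: (differentiable_comp cd ed).
by rewrite (diff_comp cd ed) /= eE -deriveE // derive_val.
Qed.

Lemma continuous_eval e : (forall p, defined e p) -> continuous (eval e).
Proof.
move=> ed p; have [? _] := is_diff_eval (ed p).
exact: differentiable_continuous.
Qed.

End Expressions.

Lemma is_coord_linear {R : realType} {V : normedModType R} (l : V -> R) :
  linear l -> continuous l -> is_coord l.
Proof.
move=> ll lc p; pose lM := GRing.isLinear.Build _ _ _ _ _ ll.
pose lL : {linear _ -> _} := HB.pack l lM.
apply: DiffDef; first exact: (@linear_differentiable _ _ _ lL p lc).
exact: (@diff_lin _ _ _ lL p lc).
Qed.

Lemma open_pos {R : realType} {V : topologicalType} {I : finType}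
    (f : I -> V -> R) :
  (forall i, continuous (f i)) -> open [set p | forall i, 0 < f i p].
Proof.
move=> fc; rewrite openE => p fp; rewrite /interior.
apply: filter_forall => i; have /= := fc i p [set x | 0 < x]; apply.
by apply: open_nbhs_nbhs; split; [exact: open_gt|exact: fp].
Qed.

(** * Smoothness of vector-valued maps *)

Section Combinations.
Context {R : realType} {V W : normedModType R} {I : finType}.
Implicit Types (e : I -> expr R V) (w : I -> W) (p v : V).

(** The vectors [w] do not depend on the point, so differentiation acts on the scalar coefficients
    alone. *)
Definition comb e w p : W := \sum_i eval (e i) p *: w i.

Lemma is_diff_comb e w p : (forall i, defined (e i) p) ->
  is_diff p (comb e w) (fun v => comb (fun i => deriv_at v (e i)) w p).
Proof.
rewrite /comb => ep; elim: (index_enum I) => [|i s ih].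
  under [X in is_diff _ X]funext do rewrite big_nil.
  under [X in is_diff _ _ X]funext do rewrite big_nil.
  exact: is_diff_cst.
under [X in is_diff _ X]funext do rewrite big_cons.
under [X in is_diff _ _ X]funext do rewrite big_cons.
have epi := is_diff_eval (ep i).
have ew : is_diff p (fun z => eval (e i) z *: w i)
    (fun v => eval (deriv_at v (e i)) p *: w i).
  apply: DiffDef; first by apply: differentiableZl.
  by rewrite diffZl // diff_val.
exact: (is_diffD ew ih).
Qed.

Lemma classC_comb (n : nat) (U : set V) e w (F : V -> W) :
  open U -> (forall p, U p -> forall i, defined (e i) p) ->
  (forall p, U p -> F p = comb e w p) -> classC n U F.
Proof.
move=> oU; elim: n e F => [|n ih] e F eU FU.
all: have dF p : U p ->
    is_diff p F (fun v => comb (fun i => deriv_at v (e i)) w p).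
1,3: move=> Up; apply: is_diff_near (is_diff_comb w (eU _ Up));
  by apply: filterS (open_nbhs_nbhs (conj oU Up)) => q /FU.
  by move=> p /dF[Fp _]; exact: differentiable_continuous.
split=> [p /dF[]//|v].
(* The directional derivative is again a combination, with differentiated coefficients; this is why
   the induction ranges over all [e] and [F]. *)
apply: (ih (fun i => deriv_at v (e i))) => p Up.
  by move=> i; exact/defined_deriv/eU.
by have [_ ->] := dF _ Up.
Qed.

Lemma smooth_on_comb (U : set V) e w (F : V -> W) :
  open U -> (forall p, U p -> forall i, defined (e i) p) ->
  (forall p, U p -> F p = comb e w p) -> smooth_on U F.
Proof. by move=> oU eU FU n; exact: classC_comb FU. Qed.

End Combinations.

(** * Polar angles *)

Section Angles.
Context {R : realType}.
Implicit Types (x y c s r : R) (m : int).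

Lemma sin_intpi m : sin (m%:~R * pi) = 0 :> R.
Proof.
have sinn (n : nat) : sin (n%:R * pi) = 0 :> R.
  rewrite -[_ * pi]add0r mulr_natl (alternatingn (@sinDpi R)).
  by rewrite sin0 mulr0.
case: m => n; first exact: sinn.
by rewrite NegzE mulrNz mulNr sinN sinn oppr0.
Qed.

Lemma cos_intpi2 m : cos (m%:~R * pi) ^+ 2 = 1 :> R.
Proof. by rewrite cos2sin2 sin_intpi expr0n subr0. Qed.

Lemma cosD_intpi x m : cos (x + m%:~R * pi) = cos x * cos (m%:~R * pi).
Proof. by rewrite cosD sin_intpi mulr0 subr0. Qed.

Lemma sinD_intpi x m : sin (x + m%:~R * pi) = sin x * cos (m%:~R * pi).
Proof. by rewrite sinD sin_intpi mulr0 addr0. Qed.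

Lemma cos_eqmod2pi x y : eqmod2pi x y -> cos x = cos y.
Proof.
move=> [m ->].
have -> : m%:~R * (2 * pi) = m%:~R * pi + m%:~R * pi :> R by ring.
by rewrite addrA !cosD_intpi -mulrA -expr2 cos_intpi2 mulr1.
Qed.

Lemma sin_eqmod2pi x y : eqmod2pi x y -> sin x = sin y.
Proof.
move=> [m ->].
have -> : m%:~R * (2 * pi) = m%:~R * pi + m%:~R * pi :> R by ring.
by rewrite addrA !sinD_intpi -mulrA -expr2 cos_intpi2 mulr1.
Qed.

Lemma cos_eq1 x : cos x = 1 -> eqmod2pi x 0.
Proof.
move=> cx1; have pi0 := pi_gt0 R.
pose m := Num.floor (x / (2 * pi)); pose y := x - m%:~R * (2 * pi).
have cy1 : cos y = cos 0.
  rewrite cos0 -cx1; apply: cos_eqmod2pi; exists (- m).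
  by rewrite /y mulrNz mulNr.
have y0 : 0 <= y.
  by rewrite subr_ge0 -ler_pdivlMr ?mulr_gt0 // /m floor_le.
have y2pi : y < 2 * pi.
  rewrite ltrBlDl -[X in _ + X]mul1r -mulrDl -ltr_pdivrMr ?mulr_gt0 //.
  by have := floorD1_gt (x / (2 * pi)); rewrite intrD.
suff y00 : y = 0 by exists m; rewrite -y00 /y subrK.
have [ylepi|piy] := leP y pi.
  by apply: (@cos_inj R) => //; rewrite in_itv /= ?y0 ?lexx // (ltW pi0).
(* The reflected angle 2 pi - y lies in [0, pi] and has cosine 1, hence is zero, which contradicts y
   < 2 pi. *)
suff : 2 * pi - y = 0 by lra.
apply: (@cos_inj R); rewrite ?in_itv /=; [lra|lra|].
rewrite -cy1 -[in RHS](cosN y); apply: cos_eqmod2pi; exists 1.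
by rewrite mul1r addrC.
Qed.

Lemma polar_eqmod2pi r x y : r != 0 ->
  r * cos x = r * cos y -> r * sin x = r * sin y -> eqmod2pi x y.
Proof.
move=> r0 /(mulfI r0) cxy /(mulfI r0) sxy.
have /cos_eq1[m] : cos (x - y) = 1.
  by rewrite cosB cxy sxy -!expr2 cos2Dsin2.
by rewrite add0r => /eqP; rewrite subr_eq addrC => /eqP E; exists m.
Qed.

(** [acos] covers the upper half-plane and its reflection the lower one. At the origin the quotient
    0 / 0 is 0; the value is then immaterial, and [arg_cos] and [arg_sin] persist because the radius
    vanishes. *)
Definition arg c s : R :=
  let a := acos (c / Num.sqrt (c ^+ 2 + s ^+ 2)) in
  if 0 <= s then a else 2 * pi - a.

Lemma hypot_gt0 c s : (c, s) != (0, 0) -> 0 < c ^+ 2 + s ^+ 2.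
Proof.
rewrite xpair_eqE negb_and lt_def addr_ge0 ?sqr_ge0 // andbT.
by rewrite paddr_eq0 ?sqr_ge0 // !sqrf_eq0 negb_and.
Qed.

Lemma hypot_sqr_le1 c s : (c / Num.sqrt (c ^+ 2 + s ^+ 2)) ^+ 2 <= 1.
Proof.
rewrite expr_div_n sqr_sqrtr ?addr_ge0 ?sqr_ge0 //.
have [[-> ->]|/hypot_gt0 cs0] := eqVneq (c, s) (0, 0).
  by rewrite expr0n mul0r.
by rewrite ler_pdivrMr // mul1r lerDl sqr_ge0.
Qed.

Lemma hypot_le1 c s : -1 <= c / Num.sqrt (c ^+ 2 + s ^+ 2) <= 1.
Proof.
rewrite -ler_norml -(expr_le1 (_ : 0 < 2)%N) // -normrX.
by rewrite ger0_norm ?sqr_ge0 // hypot_sqr_le1. Qed.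

Lemma arg_itv c s : 0 <= arg c s <= 2 * pi.
Proof.
have pi0 := pi_gt0 R.
have := acos_ge0 (hypot_le1 c s); have := acos_lepi (hypot_le1 c s).
by rewrite /arg; case: ifP => _; lra.
Qed.

Lemma arg_cos c s : Num.sqrt (c ^+ 2 + s ^+ 2) * cos (arg c s) = c.
Proof.
have -> : cos (arg c s) = c / Num.sqrt (c ^+ 2 + s ^+ 2).
  rewrite /arg; case: ifP => _; last first.
    rewrite -[RHS]acosK ?in_itv /= ?hypot_le1 // -[RHS]cosN.
    by apply: cos_eqmod2pi; exists 1; rewrite mul1r addrC.
  by rewrite acosK // in_itv /= hypot_le1.
have [[-> ->]|/hypot_gt0 cs0] := eqVneq (c, s) (0, 0).
  by rewrite !mul0r mulr0.
by rewrite mulrC divfK // gt_eqF // sqrtr_gt0.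
Qed.

Lemma arg_sin c s : Num.sqrt (c ^+ 2 + s ^+ 2) * sin (arg c s) = s.
Proof.
set rho := Num.sqrt _.
have sa : sin (acos (c / rho)) = Num.sqrt (1 - (c / rho) ^+ 2).
  exact: sin_acos (hypot_le1 c s).
have rs : rho * sin (acos (c / rho)) = `|s|.
  rewrite sa -sqrtr_sqr /rho.
  have [[-> ->]|/hypot_gt0 cs0] := eqVneq (c, s) (0, 0).
    by rewrite expr0n addr0 !sqrtr0 mul0r.
  rewrite -sqrtrM ?(ltW cs0) // expr_div_n sqr_sqrtr ?(ltW cs0) //.
  by rewrite mulrBr mulr1 mulrCA divff ?gt_eqF // mulr1 addrC addKr.
rewrite /arg -/rho; case: ifPn => [s0|]; first by rewrite rs ger0_norm.
rewrite -ltNge => s0.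
have -> : sin (2 * pi - acos (c / rho)) = - sin (acos (c / rho)).
  by rewrite -sinN; apply: sin_eqmod2pi; exists 1; rewrite mul1r addrC.
by rewrite mulrN rs ltr0_norm // opprK.
Qed.

Section LocalArgument.
Variables (alpha c s : R).
Let D := cos alpha * c + sin alpha * s.
Let N := cos alpha * s - sin alpha * c.
Hypothesis D_gt0 : 0 < D.

Let DN : D ^+ 2 + N ^+ 2 = c ^+ 2 + s ^+ 2.
Proof. by rewrite -[RHS]mul1r -(cos2Dsin2 alpha) /D /N; ring. Qed.

(** As [D] is positive, (D, N) lies in the right half-plane, where atan (N / D) is its polar angle;
    by [DN] its length is that of (c, s). *)
Let cos_delta : Num.sqrt (c ^+ 2 + s ^+ 2) * cos (atan (N / D)) = D.
Proof.
rewrite cos_atan.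
have -> : 1 + (N / D) ^+ 2 = (c ^+ 2 + s ^+ 2) / D ^+ 2.
  by rewrite -DN; field; rewrite gt_eqF.
rewrite sqrtrM; last by rewrite addr_ge0 ?sqr_ge0.
rewrite sqrtrV ?sqr_ge0 // sqrtr_sqr gtr0_norm // invfM invrK mulVKf //.
by rewrite gt_eqF // sqrtr_gt0 -DN ltr_pwDl ?exprn_gt0 ?sqr_ge0.
Qed.

Let sin_delta : Num.sqrt (c ^+ 2 + s ^+ 2) * sin (atan (N / D)) = N.
Proof.
have c0 : cos (atan (N / D)) != 0.
  by rewrite cos_atan invr_eq0 sqrtr_eq0 -ltNge ltr_pwDl ?sqr_ge0.
have /(congr1 ( *%R^~ (cos (atan (N / D))))) := atanK (N / D).
rewrite /tan divfK // => ->.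
by rewrite mulrCA cos_delta divfK // gt_eqF.
Qed.

Lemma local_arg_cos :
  Num.sqrt (c ^+ 2 + s ^+ 2) * cos (alpha + atan (N / D)) = c.
Proof.
rewrite cosD mulrBr (mulrCA _ (cos alpha)) (mulrCA _ (sin alpha)).
rewrite cos_delta sin_delta /D /N.
by rewrite -[RHS]mul1r -(cos2Dsin2 alpha); ring.
Qed.

Lemma local_arg_sin :
  Num.sqrt (c ^+ 2 + s ^+ 2) * sin (alpha + atan (N / D)) = s.
Proof.
rewrite sinD mulrDr (mulrCA _ (cos alpha)) (mulrCA _ (sin alpha)).
rewrite cos_delta sin_delta /D /N.
by rewrite -[RHS]mul1r -(cos2Dsin2 alpha); ring.
Qed.

End LocalArgument.

(* The continuous branch of arctan (c tan y): the arctangent below is that of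
   tan (arctan (c tan y) - y), and its argument has no poles. *)
Definition unwrapped_atan_tan c y : R :=
  y + atan ((c - 1) * (sin y * cos y) / (cos y ^+ 2 + c * sin y ^+ 2)).

(** The sum is a mean of 1 and c with weights cos^2 y and sin^2 y, hence at least min(1, c). *)
Lemma cos2csin2_gt0 c y : 0 < c -> 0 < cos y ^+ 2 + c * sin y ^+ 2.
Proof.
move=> c0; have [c1|/ltW c1] := leP c 1.
  have := cos2Dsin2 y; have := sqr_ge0 (cos y); have := sqr_ge0 (sin y); nra.
have := cos2Dsin2 y; have := sqr_ge0 (cos y); have := sqr_ge0 (sin y); nra.
Qed.

(** Sines and cosines enter the correction term in pairs, so their sign changes under a shift by m
    pi cancel. *)
Lemma unwrapped_atan_tan_intpi c y m :
  unwrapped_atan_tan c (y + m%:~R * pi) = unwrapped_atan_tan c y + m%:~R * pi.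
Proof.
rewrite /unwrapped_atan_tan -addrA [RHS]addrAC addrA; congr (_ + atan _).
rewrite cosD_intpi sinD_intpi !exprMn cos_intpi2 !mulr1 mulrACA -expr2.
by rewrite cos_intpi2 mulr1.
Qed.

(** The angles f = arctan (c tan y) and y have the same sign, so f - y lies in (-pi/2, pi/2) and is
    the arctangent of its tangent, which the subtraction formula turns into the quotient in
    [unwrapped_atan_tan]. *)
Lemma unwrapped_atan_tan0 c y : 0 < c -> - (pi / 2) < y < pi / 2 ->
  unwrapped_atan_tan c y = atan (c * tan y).
Proof.
move=> c0 yI; set f := atan (c * tan y).
have cy0 : 0 < cos y by exact: cos_gt0_pihalf.
have fI := atan_def (c * tan y); rewrite -/f in fI; case: fI => fI tf.
have cf0 : 0 < cos f by exact: cos_gt0_pihalf.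
have sf : sin f = c * sin y / cos y * cos f.
  by rewrite -(mulrA c) -/(tan y) -tf /tan divfK // gt_eqF.
suff dfI : - (pi / 2) < f - y < pi / 2.
  rewrite /unwrapped_atan_tan; set w := _ / _.
  suff -> : atan w = f - y by rewrite addrC subrK.
  apply: (@tan_inj R); rewrite ?in_itv /= ?atan_gtNpi2 ?atan_ltpi2 //.
  rewrite atanK /w /tan sinB cosB sf.
  have D0 := cos2csin2_gt0 y c0.
  field; rewrite !gt_eqF //=.
  suff -> : cos f * cos y * cos y + c * sin y * cos f * sin y =
      cos f * (cos y ^+ 2 + c * sin y ^+ 2) by rewrite mulr_gt0.
  by ring.
have [y0|y0] := leP 0 y.
  have : 0 <= f.
    rewrite /f -atan0; apply: le_atan.
    rewrite mulr_ge0 ?(ltW c0) // divr_ge0 ?(ltW cy0) //.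
    by apply: sin_ge0_pi; have := pi_gt0 R; lra.
  by move=> f0; lra.
have : f <= 0.
  rewrite /f -[X in _ <= X]atan0; apply: le_atan.
  rewrite -oppr_ge0 -mulrN -tanN mulr_ge0 ?(ltW c0) //.
  rewrite divr_ge0 ?cosN ?(ltW cy0) //.
  by apply: sin_ge0_pi; have := pi_gt0 R; lra.
by move=> f0; lra.
Qed.

Lemma atan_tan_unwrap c y m : 0 < c -> in_branch y m ->
  unwrapped_atan_tan c y = atan_tan c y + m%:~R * pi.
Proof.
move=> c0 ym; pose z := y - m%:~R * pi.
have -> : y = z + m%:~R * pi by rewrite /z subrK.
have zI : - (pi / 2) < z <= pi / 2.
  by move: ym; rewrite /in_branch /z; lra.
rewrite unwrapped_atan_tan_intpi; congr (_ + _).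
have e0 : cos (m%:~R * pi) != 0 :> R.
  by rewrite -sqrf_eq0 cos_intpi2 oner_eq0.
rewrite /atan_tan /tan sinD_intpi cosD_intpi mulf_eq0 (negPf e0) orbF.
rewrite -mulf_div divff // mulr1.
(* At the pole the correction term vanishes together with the cosine, so the continuous branch takes
   the value pi / 2, in agreement with the convention of [atan_tan]. *)
have [zpi|zpi] := eqVneq z (pi / 2).
  rewrite zpi cos_pihalf eqxx /unwrapped_atan_tan cos_pihalf mulr0 mulr0 mul0r.
  by rewrite atan0 addr0.
have {}zI : - (pi / 2) < z < pi / 2.
  by case/andP: zI => ->; rewrite le_eqVlt (negPf zpi).
by rewrite gt_eqF ?cos_gt0_pihalf // unwrapped_atan_tan0.
Qed.

End Angles.

Lemma is_derive_unwrapped {R : realType} (c y : R) : 0 < c ->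
  is_derive y (1 : R) (unwrapped_atan_tan c)
    (c / (cos y ^+ 2 + c ^+ 2 * sin y ^+ 2)).
Proof.
move=> c0.
pose S : expr R R := Sin (Coord id); pose K : expr R R := Cos (Coord id).
pose e : expr R R := Add (Coord id) (Atan (Mul (Mul (Const (c - 1)) (Mul S K))
  (Inv (Add (Mul K K) (Mul (Const c) (Mul S S)))))).
have D0 := cos2csin2_gt0 y c0.
have ed : defined e y.
  have did : is_coord (@id R) by move=> q; exact: is_diff_id.
  by rewrite /=; do ?[exact: did | split]; rewrite -?expr2 // gt_eqF.
have eE : eval e = unwrapped_atan_tan c.
  by apply/funext => z /=; rewrite -!expr2.
rewrite -eE; apply: is_derive_eq (is_derive_eval (is_derive_id y 1) ed) _ => /=.
have ks := cos2Dsin2 y.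
move: ks D0 {ed eE}; move: (cos y) (sin y) => k s ks {}D0.
have D2 : 0 < k ^+ 2 + c ^+ 2 * s ^+ 2.
  rewrite -exprMn; apply: hypot_gt0; apply/eqP => -[k0 /eqP].
  rewrite mulf_eq0 gt_eqF //= => /eqP s0; move: ks.
  by rewrite k0 s0 expr0n addr0 => /esym/eqP; rewrite oner_eq0.
set D := k * k + c * (s * s).
(* [field] does not know k^2 + s^2 = 1. Here and twice below a factor 1 is replaced by k^2 + s^2,
   after which both sides agree as rational functions. *)
have -> : 1 + (c - 1) * (s * k) * D^-1 * ((c - 1) * (s * k) * D^-1) =
    (k ^+ 2 + c ^+ 2 * s ^+ 2) / D ^+ 2.
  rewrite -[X in _ = X / _]mul1r -[X in _ = X * _ / _]ks /D; field.
  by rewrite -!expr2 gt_eqF.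
set T := _ * (s * k) * _ + _.
have -> : T = (c - 1) * (k ^+ 2 - c * s ^+ 2) / D ^+ 2.
  rewrite -[X in _ = X / _]mul1r -[X in _ = X * _ / _]ks /T /D; field.
  by rewrite -!expr2 gt_eqF.
rewrite -[X in _ = X / _]mulr1 -[X in _ = _ * X / _]ks /D; field.
by rewrite !gt_eqF //= exprMn.
Qed.

(** * Action-angle coordinates *)

Section Coordinates.
Context {R : realType} {d : nat}.
Implicit Types (p : phase R d) (q : actang R d) (i : 'I_d).

Let fst_continuous (V W : topologicalType) : continuous (@fst V W).
Proof. by move=> x; exact: cvg_fst. Qed.

Let snd_continuous (V W : topologicalType) : continuous (@snd V W).
Proof. by move=> x; exact: cvg_snd. Qed.

Let comp_continuous (U V W : topologicalType) (f : U -> V) (g : V -> W) :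
  continuous f -> continuous g -> continuous (g \o f).
Proof. by move=> fc gc x; apply: continuous_comp; [exact: fc|exact: gc]. Qed.

Lemma is_coord_pX i : is_coord (fun x : phase R d => pX x 0 i).
Proof.
apply: is_coord_linear => [a u v|]; first by rewrite /pX /= !mxE.
have cc : continuous (@pX R d).
  exact: comp_continuous (comp_continuous (@fst_continuous _ _)
    (@fst_continuous _ _)) (@fst_continuous _ _).
exact: comp_continuous cc (@coord_continuous _ _ _ 0 i).
Qed.

Lemma is_coord_pB : is_coord (@pB R d).
Proof.
apply: is_coord_linear => [a u v //|].
exact: comp_continuous (comp_continuous (@fst_continuous _ _)
  (@fst_continuous _ _)) (@snd_continuous _ _).
Qed.

Lemma is_coord_pk : is_coord (@pk R d).
Proof.
apply: is_coord_linear => [a u v //|].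
exact: comp_continuous (@fst_continuous _ _) (@snd_continuous _ _).
Qed.

Lemma is_coord_pbeta i : is_coord (fun x : phase R d => pbeta x 0 i).
Proof.
apply: is_coord_linear => [a u v|]; first by rewrite /pbeta /= !mxE.
have cc : continuous (@pbeta R d) by exact: snd_continuous.
exact: comp_continuous cc (@coord_continuous _ _ _ 0 i).
Qed.

Lemma is_coord_qh : is_coord (@qh R d).
Proof.
apply: is_coord_linear => [a u v //|].
exact: comp_continuous (comp_continuous (@fst_continuous _ _)
  (@fst_continuous _ _)) (@fst_continuous _ _).
Qed.

Lemma is_coord_qa i : is_coord (fun x : actang R d => qa x 0 i).
Proof.
apply: is_coord_linear => [a u v|]; first by rewrite /qa /= !mxE.
have cc : continuous (@qa R d).
  exact: comp_continuous (comp_continuous (@fst_continuous _ _)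
    (@fst_continuous _ _)) (@snd_continuous _ _).
exact: comp_continuous cc (@coord_continuous _ _ _ 0 i).
Qed.

Lemma is_coord_qxi : is_coord (@qxi R d).
Proof.
apply: is_coord_linear => [a u v //|].
exact: comp_continuous (@fst_continuous _ _) (@snd_continuous _ _).
Qed.

Lemma is_coord_qtheta i : is_coord (fun x : actang R d => qtheta x 0 i).
Proof.
apply: is_coord_linear => [a u v|]; first by rewrite /qtheta /= !mxE.
have cc : continuous (@qtheta R d) by exact: snd_continuous.
exact: comp_continuous cc (@coord_continuous _ _ _ 0 i).
Qed.

(* Standard bases: [inl (inl i)], [inl (inr i)] index the two vector components,
   [inr true], [inr false] the two scalar ones. *)
Definition coord_index := (('I_d + 'I_d) + bool)%type.

Definition phase_basis (j : coord_index) : phase R d :=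
  match j with
  | inl (inl i) => (delta_mx 0 i, 0, 0, 0)
  | inl (inr i) => (0, 0, 0, delta_mx 0 i)
  | inr true => (0, 1, 0, 0)
  | inr false => (0, 0, 1, 0)
  end.

Definition actang_basis (j : coord_index) : actang R d :=
  match j with
  | inl (inl i) => (0, delta_mx 0 i, 0, 0)
  | inl (inr i) => (0, 0, 0, delta_mx 0 i)
  | inr true => (1, 0, 0, 0)
  | inr false => (0, 0, 1, 0)
  end.

Let row_basis_sum (f : 'I_d -> R) : \row_i f i = \sum_i f i *: delta_mx 0 i.
Proof. by rewrite [LHS]row_sum_delta; apply: eq_bigr => i _; rewrite mxE. Qed.

Lemma sum_phase_basis (c : coord_index -> R) :
  \sum_j c j *: phase_basis j =
  (\row_i c (inl (inl i)), c (inr true), c (inr false),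
   \row_i c (inl (inr i))) :> phase R d.
Proof.
rewrite big_sumType /= big_sumType /= big_bool /=.
rewrite !row_basis_sum.
have -> : \sum_(i < d) c (inl (inl i)) *: (delta_mx 0 i, 0, 0, 0) =
    (\sum_i c (inl (inl i)) *: delta_mx 0 i, 0, 0, 0) :> phase R d.
  elim/big_ind2 : _ => [//|x x' y y' -> ->|i _]; congr (_, _, _, _);
  by rewrite ?addr0 ?scaler0.
have -> : \sum_(i < d) c (inl (inr i)) *: (0, 0, 0, delta_mx 0 i) =
    (0, 0, 0, \sum_i c (inl (inr i)) *: delta_mx 0 i) :> phase R d.
  elim/big_ind2 : _ => [//|x x' y y' -> ->|i _]; congr (_, _, _, _);
  by rewrite ?addr0 ?scaler0.
by congr (_, _, _, _);
  rewrite /= ?scaler0 ?addr0 ?add0r // /GRing.scale /= mulr1.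
Qed.

Lemma sum_actang_basis (c : coord_index -> R) :
  \sum_j c j *: actang_basis j =
  (c (inr true), \row_i c (inl (inl i)), c (inr false),
   \row_i c (inl (inr i))) :> actang R d.
Proof.
rewrite big_sumType /= big_sumType /= big_bool /=.
rewrite !row_basis_sum.
have -> : \sum_(i < d) c (inl (inl i)) *: (0, delta_mx 0 i, 0, 0) =
    (0, \sum_i c (inl (inl i)) *: delta_mx 0 i, 0, 0) :> actang R d.
  elim/big_ind2 : _ => [//|x x' y y' -> ->|i _]; congr (_, _, _, _);
  by rewrite ?addr0 ?scaler0.
have -> : \sum_(i < d) c (inl (inr i)) *: (0, 0, 0, delta_mx 0 i) =
    (0, 0, 0, \sum_i c (inl (inr i)) *: delta_mx 0 i) :> actang R d.
  elim/big_ind2 : _ => [//|x x' y y' -> ->|i _]; congr (_, _, _, _);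
  by rewrite ?addr0 ?scaler0.
by congr (_, _, _, _);
  rewrite /= ?scaler0 ?addr0 ?add0r // /GRing.scale /= mulr1.
Qed.

End Coordinates.

(** * The action-angle map and its symplectic local lifts *)

Section ActionAngle.
Context {R : realType} {d : nat}.
Implicit Types (p u v : phase R d) (q : actang R d) (i : 'I_d).

Definition Lsqr : expr R (phase R d) := Exp (Mul (Const 4) (Coord (@pk R d))).

Definition hE : expr R (phase R d) :=
  let B := Coord (@pB R d) in
  Mul (Const 4^-1) (Add
    (Mul (Inv Lsqr) (Add (Mul (Const 4^-1) (Mul B B)) (Const 1)))
    Lsqr).

Definition aE i : expr R (phase R d) :=
  let X := Coord (fun p => pX p 0 i) in
  let beta := Coord (fun p => pbeta p 0 i) in
  Mul (Const 2^-1) (Add (Mul X X) (Mul beta beta)).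

(* With r = sqrt (4 h^2 - 1), the pair (2 h - L^2, B / 2) is
   (r cos xi, r sin xi). *)
Definition xcosE : expr R (phase R d) :=
  Add (Mul (Const 2) hE) (Mul (Const (-1)) Lsqr).

Definition xsinE : expr R (phase R d) := Mul (Const 2^-1) (Coord (@pB R d)).

Definition action_angle p : actang R d :=
  (eval hE p, \row_i eval (aE i) p, arg (eval xcosE p) (eval xsinE p),
   \row_i arg (pbeta p 0 i) (pX p 0 i)).

Lemma Lsqr_gt0 p : 0 < eval Lsqr p.
Proof. exact: expR_gt0. Qed.

Lemma defined_Lsqr p : defined Lsqr p.
Proof. exact: (conj I (@is_coord_pk R d)). Qed.

Lemma defined_hE p : defined hE p.
Proof.
have E := defined_Lsqr p; split=> //; split=> //; split; first split=> //.
  by rewrite gt_eqF // Lsqr_gt0.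
by split=> //; split=> //; split; exact: is_coord_pB.
Qed.

Lemma defined_aE i p : defined (aE i) p.
Proof.
by split=> //; split; split; (exact: is_coord_pX || exact: is_coord_pbeta).
Qed.

Lemma defined_xcosE p : defined xcosE p.
Proof. by split; split=> //; [exact: defined_hE|exact: defined_Lsqr]. Qed.

Lemma defined_xsinE p : defined xsinE p.
Proof. by split=> //; exact: is_coord_pB. Qed.

Lemma hypot_h p :
  eval xcosE p ^+ 2 + eval xsinE p ^+ 2 = 4 * eval hE p ^+ 2 - 1.
Proof.
rewrite /=; have := expR_gt0 (4 * pk p); move: (expR _) => l l0.
by field; rewrite gt_eqF.
Qed.

Lemma hE_gt0 p : 0 < eval hE p.
Proof.
rewrite /= mulr_gt0 ?invr_gt0 // addr_gt0 ?expR_gt0 //.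
rewrite mulr_gt0 ?invr_gt0 ?expR_gt0 //.
by rewrite ltr_wpDl // mulr_ge0 ?invr_ge0 // -expr2 sqr_ge0.
Qed.

Lemma xi_cos p :
  Num.sqrt (4 * eval hE p ^+ 2 - 1) * cos (qxi (action_angle p)) =
  2 * eval hE p - eval Lsqr p.
Proof. by rewrite -hypot_h arg_cos /xcosE [in LHS]/= mulN1r. Qed.

Lemma xi_sin p :
  Num.sqrt (4 * eval hE p ^+ 2 - 1) * sin (qxi (action_angle p)) = pB p / 2.
Proof. by rewrite -hypot_h arg_sin /= mulrC. Qed.

Lemma aE2 i p : 2 * eval (aE i) p = pbeta p 0 i ^+ 2 + pX p 0 i ^+ 2.
Proof. by rewrite /= mulVKf ?pnatr_eq0 // addrC !expr2. Qed.

Lemma theta_cos i p : Num.sqrt (2 * eval (aE i) p) *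
  cos (qtheta (action_angle p) 0 i) = pbeta p 0 i.
Proof. by rewrite aE2 mxE arg_cos. Qed.

Lemma theta_sin i p : Num.sqrt (2 * eval (aE i) p) *
  sin (qtheta (action_angle p) 0 i) = pX p 0 i.
Proof. by rewrite aE2 mxE arg_sin. Qed.

Lemma nondegenerate_hBP p : ~ degenerate_hB p <-> 0 < 4 * eval hE p ^+ 2 - 1.
Proof.
have L2 : pL p ^+ 2 = eval Lsqr p.
  by rewrite /pL /= -expRM_natl; congr expR; ring.
have L0 : 0 < pL p by exact: expR_gt0.
split=> [nd|h0 [L1 B0]]; last first.
  have c0 : eval xcosE p = 0.
    by rewrite /= -[expR _]/(eval Lsqr p) -L2 L1 B0; field.
  by move: h0; rewrite -hypot_h c0 /= B0 mulr0 expr0n addr0 ltxx.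
rewrite lt_neqAle -hypot_h addr_ge0 ?sqr_ge0 // andbT eq_sym.
apply/eqP => /eqP; rewrite paddr_eq0 ?sqr_ge0 // !sqrf_eq0.
move=> /andP[/eqP c0 /eqP s0].
apply: nd; have B0 : pB p = 0 by move: s0; rewrite /= => s0; lra.
split=> //; move: c0; rewrite /= -[expR _]/(eval Lsqr p) -L2 B0.
move: (pL p) L0 => l l0 /eqP.
(* For B = 0 the difference 2 h - L^2 is (L^{-2} - L^2) / 2, whose only positive zero is L = 1. *)
rewrite (_ : _ + _ = (1 - l ^+ 2) * (1 + l ^+ 2) / (2 * l ^+ 2)); last first.
  by field; rewrite gt_eqF.
rewrite !mulf_eq0 invr_eq0 !mulf_eq0 pnatr_eq0 !(gt_eqF l0) /= orbF.
rewrite (gt_eqF (_ : 0 < 1 + l ^+ 2)) ?ltr_wpDr ?sqr_ge0 // orbF.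
rewrite subr_eq0 eq_sym.
by rewrite sqrf_eq1 => /orP[/eqP//|/eqP lN1]; move: l0; rewrite lN1 ltr0N1.
Qed.

Lemma nondegenerate_atP i p : ~ degenerate_at p i <-> 0 < eval (aE i) p.
Proof.
rewrite -(pmulr_rgt0 _ (_ : 0 < 2)) // aE2 lt_neqAle.
rewrite addr_ge0 ?sqr_ge0 // andbT eq_sym paddr_eq0 ?sqr_ge0 // !sqrf_eq0.
split=> [nd|/negP nd [X0 b0]]; last by apply: nd; rewrite X0 b0 eqxx.
by apply/negP => /andP[/eqP b0 /eqP X0]; apply: nd.
Qed.

(** [None] stands for the pair (k, B) and [Some i] for (X_i, beta_i). The single finite family of
    strict inequalities is the form expected by [open_pos]. *)
Lemma nondegenerate_setE : @nondegenerate_set R d =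
  [set p | forall j : option 'I_d,
     0 < if j is Some i then eval (aE i) p else 4 * eval hE p ^+ 2 - 1].
Proof.
apply/seteqP; split=> p /=.
  move=> nd [i|]; [apply/nondegenerate_atP|apply/nondegenerate_hBP] => dp.
    by apply: nd; left; exists i.
  by apply: nd; right.
move=> pos [[i]|]; first by apply/nondegenerate_atP; exact: (pos (Some i)).
by apply/nondegenerate_hBP; exact: (pos None).
Qed.

Lemma open_nondegenerate : open (@nondegenerate_set R d).
Proof.
rewrite nondegenerate_setE; apply: open_pos => -[i|].
  exact/continuous_eval/defined_aE.
pose e := Add (Mul (Const 4) (Mul hE hE)) (Const (-1)).
rewrite (_ : (fun _ => _) = eval e); last by apply/funext.
apply: continuous_eval => p.
by split=> //; split=> //; split; exact: defined_hE.
Qed.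

Section LocalLift.
Variables (alpha : R) (ec es : expr R (phase R d)).

Definition lift_denom : expr R (phase R d) :=
  Add (Mul (Const (cos alpha)) ec) (Mul (Const (sin alpha)) es).

Definition lift_angle : expr R (phase R d) :=
  Add (Const alpha) (Atan (Mul
    (Add (Mul (Const (cos alpha)) es) (Mul (Const (- sin alpha)) ec))
    (Inv lift_denom))).

Lemma defined_lift_angle p : defined ec p -> defined es p ->
  0 < eval lift_denom p -> defined lift_angle p.
Proof. by move=> cp sp D0; do !split=> //; rewrite gt_eqF. Qed.

Lemma eval_lift_angle p : eval lift_angle p = alpha +
  atan ((cos alpha * eval es p - sin alpha * eval ec p) /
        (cos alpha * eval ec p + sin alpha * eval es p)).
Proof. by rewrite /= mulNr. Qed.

Lemma lift_angle_eqmod2pi p : 0 < eval lift_denom p ->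
  eqmod2pi (eval lift_angle p) (arg (eval ec p) (eval es p)).
Proof.
move=> D0.
apply: (@polar_eqmod2pi _ (Num.sqrt (eval ec p ^+ 2 + eval es p ^+ 2))).
- rewrite gt_eqF // sqrtr_gt0; apply: hypot_gt0; apply/eqP => -[c0 s0].
  by move: D0; rewrite /= c0 s0 !mulr0 addr0 ltxx.
- by rewrite eval_lift_angle local_arg_cos // arg_cos.
- by rewrite eval_lift_angle local_arg_sin // arg_sin.
Qed.

(** The differential (c ds - s dc) / (c^2 + s^2) of a polar angle is the same for all lifts, so
    [alpha] drops out of the symplectic identities. *)
Lemma deriv_lift_angle p v : 0 < eval lift_denom p ->
  eval (deriv_at v lift_angle) p =
  (eval ec p * eval (deriv_at v es) p - eval es p * eval (deriv_at v ec) p) /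
  (eval ec p ^+ 2 + eval es p ^+ 2).
Proof.
rewrite /=; move: (cos2Dsin2 alpha) (eval ec p) (eval es p) => cs c s.
move: (eval (deriv_at v ec) p) (eval (deriv_at v es) p) => c' s'.
move: cs; move: (cos alpha) (sin alpha) => k l kl D0.
set D := k * c + l * s; pose N := k * s - l * c.
have DN : D ^+ 2 + N ^+ 2 = c ^+ 2 + s ^+ 2.
  by rewrite -[RHS]mul1r -kl /D /N; ring.
have DN0 : 0 < D ^+ 2 + N ^+ 2 by rewrite ltr_wpDr ?sqr_ge0 // exprn_gt0.
rewrite -DN.
have -> : c * s' - s * c' = (k ^+ 2 + l ^+ 2) * (c * s' - s * c').
  by rewrite kl mul1r.
by rewrite /D /N; field; rewrite !gt_eqF.
Qed.

End LocalLift.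

Lemma comb_actangE (e : coord_index (d := d) -> expr R (phase R d)) p :
  comb e actang_basis p =
  (eval (e (inr true)) p, \row_i eval (e (inl (inl i))) p,
   eval (e (inr false)) p, \row_i eval (e (inl (inr i))) p) :> actang R d.
Proof. exact: (sum_actang_basis (fun j => eval (e j) p)). Qed.

Lemma comb_phaseE (e : coord_index (d := d) -> expr R (actang R d)) q :
  comb e phase_basis q =
  (\row_i eval (e (inl (inl i))) q, eval (e (inr true)) q,
   eval (e (inr false)) q, \row_i eval (e (inl (inr i))) q) :> phase R d.
Proof. exact: (sum_phase_basis (fun j => eval (e j) q)). Qed.

Definition theta_lift (alpha : R) i : expr R (phase R d) :=
  lift_angle alpha (Coord (fun x => pbeta x 0 i)) (Coord (fun x => pX x 0 i)).

Definition theta_denom (alpha : R) i : expr R (phase R d) :=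
  lift_denom alpha (Coord (fun x => pbeta x 0 i)) (Coord (fun x => pX x 0 i)).

Definition local_liftE (alpha : R) (alphas : 'rV[R]_d)
    (j : coord_index (d := d)) : expr R (phase R d) :=
  match j with
  | inl (inl i) => aE i
  | inl (inr i) => theta_lift (alphas 0 i) i
  | inr true => hE
  | inr false => lift_angle alpha xcosE xsinE
  end.

(** With l = L^2 and r^2 = 4 h^2 - 1, the circle relation gives 4 l dh = (B / 2) dB + 2 (l - 2 h)
    dl, while r^2 dxi is (2 h - l) dB / 2 + (B / 2) dl modulo dh. The wedge product of the two is
    r^2 dB /\ dl, so dh /\ dxi = dB /\ dl / (4 l) = dB /\ dk. *)
Lemma symplectic_xi alpha p u v : 0 < eval (lift_denom alpha xcosE xsinE) p ->
  eval (deriv_at u hE) p * eval (deriv_at v (lift_angle alpha xcosE xsinE)) p -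
  eval (deriv_at u (lift_angle alpha xcosE xsinE)) p * eval (deriv_at v hE) p =
  pB u * pk v - pk u * pB v.
Proof.
move=> D0; have h0 : 0 < eval xcosE p ^+ 2 + eval xsinE p ^+ 2.
  apply: hypot_gt0; apply/eqP => -[c0 s0].
  move: D0; rewrite [eval _ _]/= -/(eval xcosE p) -/(eval xsinE p).
  by rewrite c0 s0 !mulr0 addr0 ltxx.
rewrite !deriv_lift_angle //; move: h0; rewrite /=; have := expR_gt0 (4 * pk p).
move: (expR _) (pB p) (pB u) (pB v) (pk u) (pk v) => l b bu bv ku kv l0 h0.
field; rewrite gt_eqF //=.
(* The denominator left by [field] is (16 l)^2 r^2, and r^2 is positive by [h0]. *)
suff -> : (2 * (b * b + 4 + l * (l * 4)) + -1 * l * (4 * (l * 4))) ^+ 2 +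
    b ^+ 2 * (4 * (l ^+ 2 * 16)) = (16 * l) ^+ 2 *
    ((2 * (4^-1 * (l^-1 * (4^-1 * (b * b) + 1) + l)) + -1 * l) ^+ 2 +
     (2^-1 * b) ^+ 2).
  by rewrite gt_eqF // mulr_gt0 // exprn_gt0 // mulr_gt0.
by field; rewrite gt_eqF.
Qed.

(** With rho^2 = 2 a this is the area form in polar coordinates: dbeta /\ dX = rho drho /\ dtheta =
    da /\ dtheta. *)
Lemma symplectic_theta alpha i p u v : 0 < eval (theta_denom alpha i) p ->
  eval (deriv_at u (theta_lift alpha i)) p * eval (deriv_at v (aE i)) p -
  eval (deriv_at u (aE i)) p * eval (deriv_at v (theta_lift alpha i)) p =
  pX u 0 i * pbeta v 0 i - pbeta u 0 i * pX v 0 i.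
Proof.
move=> D0; have h0 : 0 < pbeta p 0 i ^+ 2 + pX p 0 i ^+ 2.
  apply: hypot_gt0; apply/eqP => -[c0 s0].
  by move: D0; rewrite /= c0 s0 !mulr0 addr0 ltxx.
rewrite /theta_lift !deriv_lift_angle //= => {D0}; field.
by rewrite gt_eqF.
Qed.

Lemma local_lift p0 : nondegenerate_set p0 ->
  exists (N : set (phase R d)) (F : phase R d -> actang R d),
    [/\ open N /\ N p0, smooth_on N F,
        forall p, N p -> eqangles (F p) (action_angle p) &
        forall u v, omega_actang ('d F p0 u) ('d F p0 v) = omega_phase u v].
Proof.
rewrite nondegenerate_setE => p0nd.
(* Rotating by the angles of [p0] itself makes each denominator at [p0] equal to the radius, hence
   positive. [N] is the set where the rotated vectors stay in the right half-plane. *)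
pose alpha := qxi (action_angle p0); pose alphas := qtheta (action_angle p0).
pose denom (j : option 'I_d) : expr R (phase R d) :=
  if j is Some i then theta_denom (alphas 0 i) i
  else lift_denom alpha xcosE xsinE.
have denom_def j p : defined (denom j) p.
  case: j => [i|]; split; split=> //; [exact: is_coord_pbeta|exact: is_coord_pX
    |exact: defined_xcosE|exact: defined_xsinE].
pose N := [set p | forall j, 0 < eval (denom j) p].
pose e := local_liftE alpha alphas; pose F := comb e actang_basis.
have oN : open N by apply: open_pos => j; exact: continuous_eval.
have Np0 : N p0.
  case=> [i|].
  have := p0nd (Some i).
  rewrite -(pmulr_rgt0 _ (_ : 0 < 2)) // => a0.
  suff -> : eval (denom (Some i)) p0 = Num.sqrt (2 * eval (aE i) p0).
    by rewrite sqrtr_gt0.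
  rewrite [LHS]/= -[in LHS]theta_cos -[in X in _ + _ * X]theta_sin -/alphas.
  by rewrite -[RHS]mulr1 -(cos2Dsin2 (alphas 0 i)); ring.
  have := p0nd None => r0.
  suff -> : eval (denom None) p0 = Num.sqrt (4 * eval hE p0 ^+ 2 - 1).
    by rewrite sqrtr_gt0.
  transitivity (cos alpha * (2 * eval hE p0 - eval Lsqr p0) +
      sin alpha * (pB p0 / 2)).
    by rewrite /= mulN1r (mulrC 2^-1).
  rewrite -xi_cos -xi_sin -/alpha.
  by rewrite -[RHS]mulr1 -(cos2Dsin2 alpha); ring.
have e_def p : N p -> forall j, defined (e j) p.
  move=> Np [[i|i]|[|]]; [exact: defined_aE| |exact: defined_hE|].
    apply: defined_lift_angle; [exact: is_coord_pbeta|exact: is_coord_pX|].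
    exact: (Np (Some i)).
  apply: defined_lift_angle; [exact: defined_xcosE|exact: defined_xsinE|].
  exact: (Np None).
exists N, F; split => //.
- by apply: (smooth_on_comb (e := e) (w := actang_basis)) => //; exact: e_def.
- move=> p Np; rewrite /F comb_actangE; split=> //.
    exact: lift_angle_eqmod2pi (Np None).
  move=> i; have := lift_angle_eqmod2pi (Np (Some i)).
  by rewrite /qtheta [X in _ -> eqmod2pi X _]mxE [X in _ -> eqmod2pi _ X]mxE.
- have dF : 'd F p0 =
      (fun v => comb (fun j => deriv_at v (e j)) actang_basis p0)
      :> (phase R d -> actang R d).
    by have [_ ->] := is_diff_comb (actang_basis (d := d)) (e_def _ Np0).
  move=> u v; rewrite dF !comb_actangE /omega_actang /omega_phase.
  congr (_ + _); first exact: symplectic_xi (Np0 None).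
  apply: eq_bigr => i _; rewrite !mxE.
  exact: symplectic_theta (Np0 (Some i)).
Qed.

End ActionAngle.

(** * The inverse map and the image of the coordinates *)

Section Inverse.
Context {R : realType} {d : nat}.
Implicit Types (p : phase R d) (q : actang R d) (i : 'I_d).

(* The defining relations of the angles, which remain meaningful at degenerate
   points. *)
Record polar_coordinates p q : Prop := {
  polar_h : qh q = eval hE p;
  polar_a : forall i, qa q 0 i = eval (aE i) p;
  polar_xcos : Num.sqrt (4 * qh q ^+ 2 - 1) * cos (qxi q) =
    2 * qh q - eval Lsqr p;
  polar_xsin : Num.sqrt (4 * qh q ^+ 2 - 1) * sin (qxi q) = pB p / 2;
  polar_beta : forall i,
    Num.sqrt (2 * qa q 0 i) * cos (qtheta q 0 i) = pbeta p 0 i;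
  polar_X : forall i,
    Num.sqrt (2 * qa q 0 i) * sin (qtheta q 0 i) = pX p 0 i
}.

(** Where a radius vanishes, the relations read 0 = 0 and [coordinates_of] leaves the angle free;
    elsewhere they determine the angle modulo 2 pi. *)
Lemma coordinates_ofP p q :
  coordinates_of action_angle p q <-> polar_coordinates p q.
Proof.
split=> [[qhE qaE qxiE qthetaE]|[qhE qaE xc xs tc ts]].
  have aiE i : qa q 0 i = eval (aE i) p by rewrite qaE mxE.
  have xi_rel : Num.sqrt (4 * qh q ^+ 2 - 1) * cos (qxi q) =
      2 * qh q - eval Lsqr p /\
      Num.sqrt (4 * qh q ^+ 2 - 1) * sin (qxi q) = pB p / 2.
    rewrite qhE -xi_cos -xi_sin.
    have [->|r0] := eqVneq (Num.sqrt (4 * eval hE p ^+ 2 - 1)) 0.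
      by rewrite !mul0r.
    have /qxiE xiE : ~ degenerate_hB p.
      by apply/nondegenerate_hBP; rewrite -sqrtr_gt0 lt_def r0 sqrtr_ge0.
    by rewrite (cos_eqmod2pi xiE) (sin_eqmod2pi xiE).
  have theta_rel i :
      Num.sqrt (2 * qa q 0 i) * cos (qtheta q 0 i) = pbeta p 0 i /\
      Num.sqrt (2 * qa q 0 i) * sin (qtheta q 0 i) = pX p 0 i.
    rewrite aiE -theta_cos -theta_sin.
    have [->|r0] := eqVneq (Num.sqrt (2 * eval (aE i) p)) 0.
      by rewrite !mul0r.
    have /qthetaE thetaE : ~ degenerate_at p i.
      apply/nondegenerate_atP; rewrite -(pmulr_rgt0 _ (_ : 0 < 2)) //.
      by rewrite -sqrtr_gt0 lt_def r0 sqrtr_ge0.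
    by rewrite (cos_eqmod2pi thetaE) (sin_eqmod2pi thetaE).
  by split=> //; [exact: xi_rel.1|exact: xi_rel.2|
    move=> i; exact: (theta_rel i).1|move=> i; exact: (theta_rel i).2].
split=> //.
- by apply/rowP => i; rewrite qaE mxE.
- move=> /nondegenerate_hBP r0.
  apply: (@polar_eqmod2pi _ (Num.sqrt (4 * eval hE p ^+ 2 - 1))).
  + by rewrite gt_eqF // sqrtr_gt0.
  + by rewrite xi_cos -qhE xc.
  + by rewrite xi_sin -qhE xs.
- move=> i /nondegenerate_atP a0.
  apply: (@polar_eqmod2pi _ (Num.sqrt (2 * eval (aE i) p))).
  + by rewrite gt_eqF // sqrtr_gt0 mulr_gt0.
  + by rewrite theta_cos -qaE tc.
  + by rewrite theta_sin -qaE ts.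
Qed.

Lemma eqangles_coordinates_of p q :
  eqangles q (action_angle p) -> coordinates_of action_angle p q.
Proof. by case=> qhE qaE xiE thetaE; split. Qed.

Lemma coordinates_of_eqangles p q : nondegenerate_set p ->
  coordinates_of action_angle p q -> eqangles q (action_angle p).
Proof.
move=> nd [qhE qaE xiE thetaE]; split=> //.
  by apply: xiE => dp; apply: nd; right.
by move=> i; apply: thetaE => dp; apply: nd; left; exists i.
Qed.

Definition radiusE : expr R (actang R d) :=
  let h := Coord (@qh R d) in
  Sqrt (Add (Mul (Const 4) (Mul h h)) (Const (-1))).

Definition LsqrE : expr R (actang R d) :=
  Add (Mul (Const 2) (Coord (@qh R d)))
    (Mul (Const (-1)) (Mul (Cos (Coord (@qxi R d))) radiusE)).

Definition radiusE_at i : expr R (actang R d) :=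
  Sqrt (Mul (Const 2) (Coord (fun q => qa q 0 i))).

Definition inverseE (j : coord_index (d := d)) : expr R (actang R d) :=
  match j with
  | inl (inl i) => Mul (Sin (Coord (fun q => qtheta q 0 i))) (radiusE_at i)
  | inl (inr i) => Mul (Cos (Coord (fun q => qtheta q 0 i))) (radiusE_at i)
  | inr true => Mul (Const 2) (Mul (Sin (Coord (@qxi R d))) radiusE)
  | inr false => Mul (Const 4^-1) (Ln LsqrE)
  end.

Definition inverse : actang R d -> phase R d := comb inverseE phase_basis.

Lemma inverseP q : inverse q =
  (\row_i (sin (qtheta q 0 i) * Num.sqrt (2 * qa q 0 i)),
   2 * (sin (qxi q) * Num.sqrt (4 * qh q ^+ 2 - 1)),
   4^-1 * ln (2 * qh q - cos (qxi q) * Num.sqrt (4 * qh q ^+ 2 - 1)),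
   \row_i (cos (qtheta q 0 i) * Num.sqrt (2 * qa q 0 i))).
Proof. by rewrite /inverse comb_phaseE /= mulN1r -expr2. Qed.

(** Since sqrt (4 h^2 - 1) < 2 h, the expression for L^2 is positive at every angle, so that its
    logarithm defines k. *)
Lemma cos_sqrt_lt (h x : R) :
  0 < h -> 0 <= 4 * h ^+ 2 - 1 -> cos x * Num.sqrt (4 * h ^+ 2 - 1) < 2 * h.
Proof.
move=> h0 r0; apply: (@le_lt_trans _ _ (Num.sqrt (4 * h ^+ 2 - 1))).
  by rewrite ler_piMl ?sqrtr_ge0 // cos_le1.
have := sqr_sqrtr r0; have := sqrtr_ge0 (4 * h ^+ 2 - 1).
by move: (Num.sqrt _) => s s0 s2; rewrite ltNge; apply/negP => hs; nra.
Qed.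

Lemma polar_coordinates_inverse p q : polar_coordinates p q -> inverse q = p.
Proof.
move=> [qhE qaE xc xs tc ts]; rewrite inverseP.
case: p qhE qaE xc xs tc ts => [[[X B] k] beta] qhE qaE xc xs tc ts.
congr (_, _, _, _).
- by apply/rowP => i; rewrite mxE mulrC ts.
- by rewrite mulrC (mulrC (sin _)) xs divfK.
- rewrite (mulrC (cos _)) xc opprB addrC subrK /= expRK.
  by rewrite mulKf ?pnatr_eq0.
- by apply/rowP => i; rewrite mxE mulrC tc.
Qed.

Lemma polar_coordinates_of_inverse q : 0 < qh q -> 0 <= 4 * qh q ^+ 2 - 1 ->
  (forall i, 0 <= qa q 0 i) -> polar_coordinates (inverse q) q.
Proof.
move=> h0 r0 a0; rewrite inverseP; set r := Num.sqrt (4 * _ - 1).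
have r2 : r ^+ 2 = 4 * qh q ^+ 2 - 1 by rewrite sqr_sqrtr.
have l0 : 0 < 2 * qh q - cos (qxi q) * r by rewrite subr_gt0 cos_sqrt_lt.
have lE : expR (4 * (4^-1 * ln (2 * qh q - cos (qxi q) * r))) =
    2 * qh q - cos (qxi q) * r.
  by rewrite mulVKf ?pnatr_eq0 // lnK.
split=> /=.
- rewrite /pk /pB /= lE.
  have s2 := sin2cos2 (qxi q).
  (* The circle relation 4 h l = (B / 2)^2 + 1 + l^2, from which h is recovered on division by 4
     l. *)
  have : 4 * (qh q * (2 * qh q - cos (qxi q) * r)) =
      (sin (qxi q) * r) ^+ 2 + 1 + (2 * qh q - cos (qxi q) * r) ^+ 2.
    by rewrite exprMn s2 r2; ring: r2.
  move: l0; set l := _ - _ => l0 e.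
  apply: (mulIf (_ : l != 0)); first by rewrite gt_eqF.
  apply: (mulfI (_ : 4 != 0 :> R)); first by rewrite pnatr_eq0.
  by rewrite e; field; rewrite gt_eqF.
- move=> i; rewrite /pX /pbeta /= !mxE; have ai := a0 i.
  rewrite -!expr2 !exprMn !sqr_sqrtr ?mulr_ge0 //.
  have c2 := cos2Dsin2 (qtheta q 0 i).
  by rewrite -[LHS]mul1r -c2; field; rewrite c2 oner_eq0.
- by rewrite /pk /= lE subKr mulrC.
- by rewrite /pB /= (mulrC 2) mulfK ?pnatr_eq0 // mulrC.
- by move=> i; rewrite mxE mulrC.
- by move=> i; rewrite mxE mulrC.
Qed.

Lemma gt_half_sqr (h : R) : 0 < h -> (0 < 4 * h ^+ 2 - 1) = (0 < 2 * h - 1).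
Proof.
move=> h0; have -> : 4 * h ^+ 2 - 1 = (2 * h - 1) * (2 * h + 1) by ring.
by rewrite pmulr_lgt0 // addr_gt0 // mulr_gt0.
Qed.

(** The image is cut out by conditions on h and a alone, which shows that it is open and that the
    square roots and the logarithm in [inverse] are smooth on it. Preimages are supplied by
    [inverse]. *)
Lemma actang_imageE :
  [set q : actang R d |
    exists2 p, nondegenerate_set p & eqangles q (action_angle p)] =
  [set q | forall j : option 'I_d,
     0 < if j is Some i then qa q 0 i else 2 * qh q - 1].
Proof.
apply/seteqP; split=> q /=.
  move=> [p]; rewrite nondegenerate_setE => nd [qhE qaE _ _] [i|].
    by rewrite qaE mxE; exact: (nd (Some i)).
  by have := nd None; rewrite gt_half_sqr ?hE_gt0 // qhE.
move=> pos; have h1 : 0 < 2 * qh q - 1 := pos None.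
have h0 : 0 < qh q by lra.
have r0 : 0 < 4 * qh q ^+ 2 - 1 by rewrite gt_half_sqr.
have pq : polar_coordinates (inverse q) q.
  apply: polar_coordinates_of_inverse => //; first exact: ltW.
  by move=> i; exact: ltW (pos (Some i)).
have nd : nondegenerate_set (inverse q).
  rewrite nondegenerate_setE => -[i|].
    by rewrite -(polar_a pq); exact: (pos (Some i)).
  by rewrite -(polar_h pq).
exists (inverse q) => //.
by apply: coordinates_of_eqangles => //; exact/coordinates_ofP.
Qed.

Lemma symplectic_action_angle :
  symplectic_change (@nondegenerate_set R d) action_angle.
Proof.
split.
- exact: open_nondegenerate.
- move=> p _; split; first exact: arg_itv.
  by move=> i; rewrite mxE; exact: arg_itv.
- exact: local_lift.
rewrite actang_imageE => V.
have oV : open V.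
  apply: open_pos => -[i|].
    pose e := Coord (fun q : actang R d => qa q 0 i).
    exact: (@continuous_eval _ _ e (fun=> is_coord_qa i)).
  pose e := Add (Mul (Const 2) (Coord (@qh R d))) (Const (-1)).
  rewrite (_ : (fun _ => _) = eval e); last by apply/funext.
  apply: continuous_eval => q; split=> //; split=> //; exact: is_coord_qh.
split=> //; exists inverse; split; last first.
  move=> p q _ /eqangles_coordinates_of/coordinates_ofP.
  exact: polar_coordinates_inverse.
apply: (smooth_on_comb (e := inverseE) (w := phase_basis)) => // q Vq.
have h1 : 0 < 2 * qh q - 1 := Vq None.
have h0 : 0 < qh q by lra.
have r0 : 0 < 4 * qh q ^+ 2 - 1 by rewrite gt_half_sqr.
have rdef : defined radiusE q.
  split; last by rewrite /= -expr2.
  by split=> //; split=> //; split; exact: is_coord_qh.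
have adef i : defined (radiusE_at i) q.
  split; last by rewrite /= mulr_gt0 //; exact: (Vq (Some i)).
  by split=> //; exact: is_coord_qa.
case=> [[i|i]|[|]].
- by split=> //; exact: is_coord_qtheta.
- by split=> //; exact: is_coord_qtheta.
- by split=> //; split=> //; exact: is_coord_qxi.
- split=> //; split.
    split; first by split=> //; exact: is_coord_qh.
    by split=> //; split=> //; exact: is_coord_qxi.
  rewrite /= mulN1r subr_gt0 -expr2; apply: cos_sqrt_lt => //; exact: ltW.
Qed.

Lemma hamiltonian_action_angle p :
  hamiltonian p = new_hamiltonian (action_angle p).
Proof.
rewrite /hamiltonian /new_hamiltonian /sqnorm2 -addrA -big_split /= mulr_sumr.
congr (_ + _).
  rewrite expRN /qh /=; have := expR_gt0 (4 * pk p); move: (expR _) => l l0.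
  by field; rewrite gt_eqF.
by apply: eq_bigr => i _; rewrite mxE aE2 addrC.
Qed.

Lemma continuous_action_h : continuous (fun p => qh (action_angle p)).
Proof. by apply: (@continuous_eval _ _ hE); exact: defined_hE. Qed.

Lemma continuous_action_a : continuous (fun p => qa (action_angle p)).
Proof.
pose w (i : 'I_d) : 'rV[R]_d := delta_mx 0 i.
suff C0 : classC 0 setT (fun p => qa (action_angle p)) by move=> p; exact: C0.
apply: (@classC_comb _ _ _ _ 0 setT (@aE R d) w _ openT) => [p _ i|p _].
  exact: defined_aE.
by rewrite [LHS]row_sum_delta; apply: eq_bigr => i _; rewrite mxE.
Qed.

End Inverse.

(** * Solutions of the modulation system *)

Section RealCurves.
Context {R : realType}.

Lemma is_derive_pair {V W : normedModType R} (f : R -> V) (g : R -> W) t df dg :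
  is_derive t (1 : R) f df -> is_derive t (1 : R) g dg ->
  is_derive t (1 : R) (fun u => (f u, g u)) (df, dg).
Proof.
move=> ft gt.
have fd : differentiable f t by apply/derivable1_diffP; exact: ex_derive.
have gd : differentiable g t by apply/derivable1_diffP; exact: ex_derive.
apply: DeriveDef; first exact/derivable1_diffP/differentiable_pair.
rewrite deriveE; last exact: differentiable_pair.
by rewrite diff_pair //= -!deriveE // !derive_val.
Qed.

Lemma is_derive_rowP {n : nat} (f : R -> 'rV[R]_n) t (df : 'rV[R]_n) :
  is_derive t (1 : R) f df <->
  forall i, is_derive t (1 : R) (fun u => f u 0 i) (df 0 i).
Proof.
split=> [ft i|ft].
  have fd : derivable f t 1 by exact: ex_derive.
  apply: DeriveDef; first exact: (derivable_mxP f t 1).1.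
  by have := derive_mx fd; rewrite derive_val => ->; rewrite mxE.
have fd : derivable f t 1.
  by apply/derivable_mxP => i j; rewrite ord1; have ? := ft j; exact: ex_derive.
apply: DeriveDef => //; rewrite derive_mx //; apply/rowP => i.
by rewrite mxE; have [_ ->] := ft i.
Qed.

Lemma is_derive_fun_add (f g : R -> R) t df dg :
  is_derive t (1 : R) f df -> is_derive t (1 : R) g dg ->
  is_derive t (1 : R) (fun u => f u + g u) (df + dg).
Proof. exact: is_deriveD. Qed.

Lemma is_derive_fun_opp (f : R -> R) t df :
  is_derive t (1 : R) f df -> is_derive t (1 : R) (fun u => - f u) (- df).
Proof. exact: is_deriveN. Qed.

Lemma is_derive_fun_mul (f g : R -> R) t df dg :
  is_derive t (1 : R) f df -> is_derive t (1 : R) g dg ->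
  is_derive t (1 : R) (fun u => f u * g u) (f t * dg + g t * df).
Proof. exact: is_deriveM. Qed.

Lemma is_derive_dot {n : nat} (f g : R -> 'rV[R]_n) t (df dg : 'rV[R]_n) :
  is_derive t (1 : R) f df -> is_derive t (1 : R) g dg ->
  is_derive t (1 : R) (fun u => \sum_i f u 0 i * g u 0 i)
    (\sum_i (f t 0 i * dg 0 i + g t 0 i * df 0 i)).
Proof.
move=> /is_derive_rowP ft /is_derive_rowP gt.
have := @is_derive_sum _ _ _ n (fun i => fun u => f u 0 i * g u 0 i) t 1 _
  (fun i => is_derive_fun_mul (ft i) (gt i)).
by rewrite fct_sumE.
Qed.

Lemma is_derive0_interval (J : set R) (f : R -> R) : is_interval J ->
  (forall t, J t -> is_derive t (1 : R) f 0) ->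
  forall s t, J s -> J t -> f s = f t.
Proof.
move=> iJ f0; suff le_case s t : s <= t -> J s -> J t -> f s = f t.
  by move=> s t Js Jt; case: (leP s t) => [/le_case|/ltW/le_case fts];
    [exact|apply/esym/fts].
move=> st Js Jt.
have sub u : u \in `[s, t] -> J u.
  by rewrite in_itv /=; exact: iJ.
have fd u : u \in `]s, t[ -> is_derive u (1 : R) f 0.
  by move=> ust; apply/f0/sub; exact: subset_itv_oo_cc.
have fc : {within `[s, t], continuous f}.
  by apply: derivable_within_continuous => u /sub/f0 fu; exact: ex_derive.
have [u _ /eqP] := @MVT_segment _ f (fun=> 0) s t st fd fc.
by rewrite mul0r subr_eq0 => /eqP.
Qed.

(** Rotating (f, g) back by the angle w t gives two functions with zero derivative; their constancy
    is [I1] and [I2], a linear system that is then solved for f and g. *)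
Lemma rotation_solution (J : set R) (w : R) (f g : R -> R) :
  is_interval J -> J 0 ->
  (forall t, J t -> is_derive t (1 : R) f (w * g t)) ->
  (forall t, J t -> is_derive t (1 : R) g (- (w * f t))) ->
  forall t, J t -> f t = f 0 * cos (w * t) + g 0 * sin (w * t) /\
                   g t = g 0 * cos (w * t) - f 0 * sin (w * t).
Proof.
move=> iJ J0 fd gd t Jt.
pose wt : expr R R := Mul (Const w) (Coord id).
have wtd u : defined wt u by split=> // v; exact: is_diff_id.
have cosd u : is_derive u (1 : R) (fun u => cos (w * u)) (- (w * sin (w * u))).
  have wd : defined (Cos wt) u by exact: wtd.
  apply: is_derive_eq (is_derive_eval (is_derive_id u 1) wd) _.
  by rewrite /=; ring.
have sind u : is_derive u (1 : R) (fun u => sin (w * u)) (w * cos (w * u)).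
  have wd : defined (Sin wt) u by exact: wtd.
  apply: is_derive_eq (is_derive_eval (is_derive_id u 1) wd) _.
  by rewrite /=; ring.
have I1 : f t * cos (w * t) + - g t * sin (w * t) = f 0.
  transitivity (f 0 * cos (w * 0) + - g 0 * sin (w * 0)); last first.
    by rewrite mulr0 cos0 sin0 mulr1 mulr0 addr0.
  pose F u := f u * cos (w * u) + - g u * sin (w * u).
  apply: (@is_derive0_interval J F) => // u Ju.
  apply: is_derive_eq (is_derive_fun_add (is_derive_fun_mul (fd u Ju) (cosd u))
    (is_derive_fun_mul (is_derive_fun_opp (gd u Ju)) (sind u))) _.
  by ring.
have I2 : f t * sin (w * t) + g t * cos (w * t) = g 0.
  transitivity (f 0 * sin (w * 0) + g 0 * cos (w * 0)); last first.
    by rewrite mulr0 cos0 sin0 mulr1 mulr0 add0r.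
  pose F u := f u * sin (w * u) + g u * cos (w * u).
  apply: (@is_derive0_interval J F) => // u Ju.
  apply: is_derive_eq (is_derive_fun_add (is_derive_fun_mul (fd u Ju) (sind u))
    (is_derive_fun_mul (gd u Ju) (cosd u))) _.
  by ring.
have cs := cos2Dsin2 (w * t).
rewrite -I1 -I2; split.
  by rewrite -[LHS]mulr1 -cs; ring.
by rewrite -[LHS]mulr1 -cs; ring.
Qed.

End RealCurves.

(** * The Hamiltonian field in the new coordinates *)

Section HamiltonianField.
Context {R : realType} {d : nat}.
Implicit Types (p : phase R d) (i : 'I_d).

(** The right-hand side of the modulation system. Taking [deriv_at] in this direction is
    differentiation along the flow, so conservation laws and rotation equations become algebraic
    identities. *)
Definition hamiltonian_field p : phase R d :=
  (2 *: pbeta p,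
   - (4 / eval Lsqr p) + 4 * eval Lsqr p - pB p ^+ 2 / eval Lsqr p,
   - (pB p / (2 * eval Lsqr p)),
   - (2 *: pX p)).

Lemma sqr_expR2 (x : R) : expR (2 * x) ^+ 2 = expR (4 * x).
Proof. by rewrite -expRM_natl; congr expR; ring. Qed.

Lemma pB_field p : pB (hamiltonian_field p) =
  - (4 / expR (4 * pk p)) + 4 * expR (4 * pk p) - pB p ^+ 2 / expR (4 * pk p).
Proof. by []. Qed.

Lemma pk_field p : pk (hamiltonian_field p) = - (pB p / (2 * expR (4 * pk p))).
Proof. by []. Qed.

Lemma hamiltonian_field_h p : eval (deriv_at (hamiltonian_field p) hE) p = 0.
Proof.
rewrite /= pB_field pk_field.
have := expR_gt0 (4 * pk p); move: (expR _) (pB p) => l b l0.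
by field; rewrite gt_eqF.
Qed.

Lemma hamiltonian_field_xcos p :
  eval (deriv_at (hamiltonian_field p) xcosE) p = 4 * eval xsinE p.
Proof.
rewrite /= pB_field pk_field.
have := expR_gt0 (4 * pk p); move: (expR _) (pB p) => l b l0.
by field; rewrite gt_eqF.
Qed.

Lemma hamiltonian_field_xsin p :
  eval (deriv_at (hamiltonian_field p) xsinE) p = - (4 * eval xcosE p).
Proof.
rewrite /= pB_field.
have := expR_gt0 (4 * pk p); move: (expR _) (pB p) => l b l0.
by field; rewrite gt_eqF.
Qed.

Lemma hamiltonian_field_a i p :
  eval (deriv_at (hamiltonian_field p) (aE i)) p = 0.
Proof. by rewrite /= /hamiltonian_field /pX /pbeta /= !mxE; ring. Qed.

Lemma flow_qh (q : actang R d) t : qh (flow_actang q t) = qh q.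
Proof. by []. Qed.

Lemma flow_qa (q : actang R d) t : qa (flow_actang q t) = qa q.
Proof. by []. Qed.

Lemma flow_qxi (q : actang R d) t : qxi (flow_actang q t) = qxi q - 4 * t.
Proof. by []. Qed.

Lemma flow_qtheta (q : actang R d) t i :
  qtheta (flow_actang q t) 0 i = qtheta q 0 i + 2 * t.
Proof. by rewrite mxE. Qed.

End HamiltonianField.

Section Solutions.
Context {R : realType} {d : nat} {J : set R} {A k B : R -> R}
  {X beta : R -> 'rV[R]_d} {gamma s : R -> R}.
Hypotheses (iJ : is_interval J) (J0 : J 0)
  (sol : modulation_solution J A k B X beta gamma s).

Let p t : phase R d := (X t, B t, k t, beta t).

(** The system prescribes the derivative of L = e^{2k}; k is recovered as (ln L) / 2. *)
Lemma solution_k t : J t ->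
  is_derive t (1 : R) k (- (B t / (2 * expR (4 * k t)))).
Proof.
move=> Jt; pose e : expr R R := Mul (Const 2^-1) (Ln (Coord id)).
have ed : defined e (expR (2 * k t)).
  by split=> //; split; [move=> u; exact: is_diff_id|exact: expR_gt0].
have kE : (fun u => eval e (expR (2 * k u))) = k.
  by apply/funext => u; rewrite /= expRK mulKf // pnatr_eq0.
rewrite -{1}kE; apply: is_derive_eq (is_derive_eval (eq_L sol Jt) ed) _.
rewrite /= -sqr_expR2; have := expR_gt0 (2 * k t).
by move: (expR _) => l l0; field; rewrite gt_eqF.
Qed.

Lemma solution_phase t : J t ->
  is_derive t (1 : R) p (hamiltonian_field (p t)).
Proof.
move=> Jt; have LE : eval Lsqr (p t) = expR (2 * k t) ^+ 2 by rewrite sqr_expR2.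
rewrite /hamiltonian_field LE.
apply: is_derive_pair (eq_beta sol Jt); apply: is_derive_pair.
  by apply: is_derive_pair; [exact: (eq_X sol)|exact: (eq_B sol)].
by rewrite sqr_expR2; exact: solution_k.
Qed.

Lemma solution_conserved (e : expr R (phase R d)) t :
  (forall q, defined e q) ->
  (forall q, eval (deriv_at (hamiltonian_field q) e) q = 0) ->
  J t -> eval e (p t) = eval e (p 0).
Proof.
move=> ed e0 Jt.
apply: (@is_derive0_interval _ J (fun u => eval e (p u))) => // u Ju.
by have := is_derive_eval (solution_phase Ju) (ed (p u)); rewrite e0.
Qed.

Lemma solution_rotation (w : R) (e1 e2 : expr R (phase R d)) t :
  (forall q, defined e1 q) -> (forall q, defined e2 q) ->
  (forall q, eval (deriv_at (hamiltonian_field q) e1) q = w * eval e2 q) ->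
  (forall q, eval (deriv_at (hamiltonian_field q) e2) q = - (w * eval e1 q)) ->
  J t ->
  eval e1 (p t) = eval e1 (p 0) * cos (w * t) + eval e2 (p 0) * sin (w * t) /\
  eval e2 (p t) = eval e2 (p 0) * cos (w * t) - eval e1 (p 0) * sin (w * t).
Proof.
move=> d1 d2 E1 E2.
apply: (@rotation_solution _ J w
  (fun u => eval e1 (p u)) (fun u => eval e2 (p u))) => // u Ju.
  by have := is_derive_eval (solution_phase Ju) (d1 (p u)); rewrite E1.
by have := is_derive_eval (solution_phase Ju) (d2 (p u)); rewrite E2.
Qed.

Lemma solution_h t : J t -> eval hE (p t) = eval hE (p 0).
Proof.
by apply: solution_conserved; [exact: defined_hE|exact: hamiltonian_field_h].
Qed.

Lemma solution_a i t : J t -> eval (aE i) (p t) = eval (aE i) (p 0).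
Proof.
by apply: solution_conserved; [exact: defined_aE|exact: hamiltonian_field_a].
Qed.

Lemma solution_nondegenerate t : J t ->
  nondegenerate_set (p 0) -> nondegenerate_set (p t).
Proof.
move=> Jt; rewrite !nondegenerate_setE => nd [i|].
  by move: (nd (Some i)); rewrite -(solution_a i Jt).
by move: (nd None); rewrite -(solution_h Jt).
Qed.

Lemma solution_polar (q0 : actang R d) t : J t ->
  polar_coordinates (p 0) q0 -> polar_coordinates (p t) (flow_actang q0 t).
Proof.
move=> Jt [hE0 aE0 xc0 xs0 tc0 ts0].
have ht := solution_h Jt.
have xcosE0 q : eval xcosE q = 2 * eval hE q - eval Lsqr q.
  by rewrite [LHS]/= mulN1r.
have xsinE0 (q : phase R d) : eval xsinE q = pB q / 2 by rewrite /= mulrC.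
have [xct xst] := solution_rotation (@defined_xcosE R d) (@defined_xsinE R d)
  (@hamiltonian_field_xcos R d) (@hamiltonian_field_xsin R d) Jt.
(* The pair is taken in the order (X_i, beta_i), that is (sin, cos), against (cos, sin) for xi; the
   same rotation lemma thus makes theta_i increase and xi decrease. *)
have theta i := solution_rotation (w := 2) (e1 := Coord (fun x => pX x 0 i))
  (e2 := Coord (fun x => pbeta x 0 i)) (t := t)
  (fun=> is_coord_pX i) (fun=> is_coord_pbeta i).
split; rewrite ?flow_qh ?flow_qa ?flow_qxi.
- by rewrite ht -hE0.
- by move=> i; rewrite solution_a // -aE0.
- transitivity (eval xcosE (p t)); last by rewrite xcosE0 ht hE0.
  rewrite xct xcosE0 xsinE0 -hE0 -xc0 -xs0 cosB; ring.
- transitivity (eval xsinE (p t)); last by rewrite xsinE0.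
  rewrite xst xcosE0 xsinE0 -hE0 -xc0 -xs0 sinB; ring.
- move=> i; rewrite flow_qtheta cosD.
  transitivity (pbeta (p 0) 0 i * cos (2 * t) - pX (p 0) 0 i * sin (2 * t)).
    by rewrite -tc0 -ts0; ring.
  by apply/esym; apply: (theta i _ _ Jt).2 => q; rewrite /= /pX /pbeta /= !mxE.
- move=> i; rewrite flow_qtheta sinD.
  transitivity (pX (p 0) 0 i * cos (2 * t) + pbeta (p 0) 0 i * sin (2 * t)).
    by rewrite -tc0 -ts0; ring.
  by apply/esym; apply: (theta i _ _ Jt).1 => q; rewrite /= /pX /pbeta /= !mxE.
Qed.

End Solutions.

(** * Explicit formulae along a solution *)

Section ExplicitFormulae.
Context {R : realType}.

Lemma is_derive_affine (a b t : R) : is_derive t (1 : R) (fun u => a + b * u) b.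
Proof.
pose e : expr R R := Add (Const a) (Mul (Const b) (Coord id)).
have ed : defined e t by split=> //; split=> // u; exact: is_diff_id.
apply: is_derive_eq (is_derive_eval (is_derive_id t 1) ed) _.
by rewrite /=; ring.
Qed.

(** The constant c = 2 h + r has inverse 2 h - r, so (cos^2 y + c^2 sin^2 y) / c = (2 h - r) cos^2 y
    + (2 h + r) sin^2 y = 2 h - r cos (2 y). The factors -1/2 and -2 cancel. *)
Lemma is_derive_rescaled_time (h x t : R) : 0 < h -> 0 <= 4 * h ^+ 2 - 1 ->
  let r := Num.sqrt (4 * h ^+ 2 - 1) in
  is_derive t (1 : R)
    (fun u => - 2^-1 * unwrapped_atan_tan (2 * h + r) (x / 2 - 2 * u))
    (2 * h - cos (x - 4 * t) * r)^-1.
Proof.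
move=> h0 r0 /=; set r := Num.sqrt _; set c := 2 * h + r.
set y := x / 2 - 2 * t.
have r_ge0 : 0 <= r by exact: sqrtr_ge0.
have r2 : r ^+ 2 = 4 * h ^+ 2 - 1 by rewrite sqr_sqrtr.
have c0 : 0 < c by rewrite ltr_pwDl // mulr_gt0.
have l0 : 0 < 2 * h - cos (x - 4 * t) * r by rewrite subr_gt0 cos_sqrt_lt.
have dy : is_derive t (1 : R) (fun u => x / 2 - 2 * u) (- 2).
  have := is_derive_affine (x / 2) (- 2) t.
  by under [X in is_derive _ _ X _ -> _]funext do rewrite mulNr.
have dphi := @is_derive1_comp _ _ (fun u => x / 2 - 2 * u) t _ _
  (is_derive_unwrapped y c0) dy.
have d0 : is_derive t (1 : R) (fun=> - 2^-1 : R) 0 by exact: is_derive_cst.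
apply: is_derive_eq (is_derive_fun_mul d0 dphi) _.
have xE : x - 4 * t = y + y by rewrite /y; field.
move: l0; rewrite xE cosD -!expr2 mulr0 addr0.
have := cos2Dsin2 y; move: (cos y) (sin y) => p q pq l0.
have cE : p ^+ 2 + c ^+ 2 * q ^+ 2 = c * (2 * h - (p ^+ 2 - q ^+ 2) * r).
  have -> : 2 * h - (p ^+ 2 - q ^+ 2) * r =
      2 * h * (p ^+ 2 + q ^+ 2) - (p ^+ 2 - q ^+ 2) * r by rewrite pq mulr1.
  by rewrite /c; ring: r2.
rewrite cE; field.
by rewrite !gt_eqF.
Qed.

End ExplicitFormulae.

Section SolutionFormulae.
Context {R : realType} {d : nat} {J : set R} {A k B : R -> R}
  {X beta : R -> 'rV[R]_d} {gamma s : R -> R}.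
Hypotheses (iJ : is_interval J) (J0 : J 0)
  (sol : modulation_solution J A k B X beta gamma s).

Let p t : phase R d := (X t, B t, k t, beta t).

(** The equation reads A_t = (2 - d) k_t A, so A e^{-(2 - d) k} is constant. No logarithm of A is
    taken, which leaves its sign free. *)
Lemma solution_A t : J t -> A t = A 0 * expR ((2 - d%:R) * (k t - k 0)).
Proof.
move=> Jt; pose m : R := 2 - d%:R.
suff : A t * expR (- m * k t) = A 0 * expR (- m * k 0).
  move=> /(congr1 ( *%R^~ (expR (m * k t)))).
  rewrite -!mulrA -!expRD mulNr addNr expR0 mulr1 => ->.
  by congr (_ * expR _); rewrite /m; ring.
pose e : expr R R := Exp (Mul (Const (- m)) (Coord id)).
have ed u : defined e u by split=> // v; exact: is_diff_id.
apply: (@is_derive0_interval _ J (fun u => A u * eval e (k u))) => // u Ju.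
have ku := is_derive_eval (solution_k sol Ju) (ed (k u)).
apply: is_derive_eq (is_derive_fun_mul (eq_A sol Ju) ku) _.
rewrite sqr_expR2 /= /m; have := expR_gt0 (4 * k u).
by move: (expR (4 * k u)) => l l0; field; rewrite gt_eqF.
Qed.

(** The derivative of the scalar product of X and beta is 2 (|beta|^2 - |X|^2) = 2 gamma_t. *)
Lemma solution_gamma t : J t -> gamma t = gamma 0 +
  2^-1 * (\sum_i X t 0 i * beta t 0 i - \sum_i X 0 0 i * beta 0 0 i).
Proof.
move=> Jt.
suff : gamma t + - (2^-1 * \sum_i X t 0 i * beta t 0 i) =
       gamma 0 + - (2^-1 * \sum_i X 0 0 i * beta 0 0 i).
  by rewrite mulrBr; lra.
apply: (@is_derive0_interval _ J
  (fun u => gamma u + - (2^-1 * \sum_i X u 0 i * beta u 0 i))) => // u Ju.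
have Xbu := is_derive_dot (eq_X sol Ju) (eq_beta sol Ju).
have d0 : is_derive u (1 : R) (fun=> 2^-1 : R) 0 by exact: is_derive_cst.
apply: is_derive_eq (is_derive_fun_add (eq_gamma sol Ju)
  (is_derive_fun_opp (is_derive_fun_mul d0 Xbu))) _.
rewrite mulr0 addr0 /sqnorm2 -sumrB mulr_sumr -sumrN -big_split /=.
apply: big1 => i _.
by rewrite !mxE; field.
Qed.

(** As functions of t both sides vanish at 0 and have derivative L^{-2}, with L^2 given by
    [solution_polar]. *)
Lemma solution_s (q0 : actang R d) t :
  J t -> polar_coordinates (p 0) q0 ->
  let c := 2 * qh q0 + Num.sqrt (4 * qh q0 ^+ 2 - 1) in
  s t = - 2^-1 * unwrapped_atan_tan c (qxi q0 / 2 - 2 * t) +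
        2^-1 * unwrapped_atan_tan c (qxi q0 / 2).
Proof.
move=> Jt pq /=; set c := 2 * _ + _.
have h0 : 0 < qh q0 by rewrite (polar_h pq) hE_gt0.
have r0 : 0 <= 4 * qh q0 ^+ 2 - 1.
  by rewrite (polar_h pq) -hypot_h addr_ge0 // sqr_ge0.
pose phi u := - 2^-1 * unwrapped_atan_tan c (qxi q0 / 2 - 2 * u).
suff : s t + - phi t = s 0 + - phi 0.
  rewrite (init_s sol) /phi mulr0 subr0 => /eqP; lra.
apply: (@is_derive0_interval _ J (fun u => s u + - phi u)) => // u Ju.
apply: is_derive_eq (is_derive_fun_add (eq_s sol Ju)
  (is_derive_fun_opp (is_derive_rescaled_time (qxi q0) u h0 r0))) _.
have := polar_xcos (solution_polar iJ J0 sol Ju pq).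
rewrite flow_qxi flow_qh => xc.
by rewrite sqr_expR2 [_ * Num.sqrt _]mulrC xc subKr; exact: subrr.
Qed.

Lemma solution_explicit (q0 : actang R d) t :
  J t -> polar_coordinates (p 0) q0 ->
  explicit_formulae q0 t A k B X beta gamma s.
Proof.
move=> Jt pq; have pt := solution_polar iJ J0 sol Jt pq.
have h0 : 0 < qh q0 by rewrite (polar_h pq) hE_gt0.
have r0 : 0 <= 4 * qh q0 ^+ 2 - 1.
  by rewrite (polar_h pq) -hypot_h addr_ge0 // sqr_ge0.
split.
- split=> // i; by rewrite (polar_a pq) aE2 addr_ge0 // sqr_ge0.
- rewrite solution_A // /powR gt_eqF ?divr_gt0 ?expR_gt0 //.
  by rewrite -expRB expRK; congr (_ * expR _); field.
- split; first by rewrite sqr_expR2.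
  by rewrite sqr_expR2 [X in _ - X]mulrC (polar_xcos pt) subKr.
- rewrite -mulrA [sin _ * _]mulrC (polar_xsin pt) /pB /=.
  by field.
- by move=> i; rewrite mulrC (polar_X pt).
- by move=> i; rewrite mulrC (polar_beta pt).
- rewrite solution_gamma // -sumrB mulr_sumr; congr (_ + _).
  apply: eq_bigr => i _.
  (* By the double-angle formula a_i sin (2 theta_i) / 2 is X_i beta_i / 2, the quantity in
     [solution_gamma]. *)
  have sin2 (a y : R) : 0 <= 2 * a ->
      a / 2 * sin (2 * y) =
      2^-1 * (Num.sqrt (2 * a) * sin y * (Num.sqrt (2 * a) * cos y)).
    move=> a0; rewrite mulrACA -expr2 sqr_sqrtr // mulr_natl sin_mulr2n.
    by rewrite -mulr_natl; field.
  have a0 : 0 <= 2 * qa q0 0 i by rewrite (polar_a pq) aE2 addr_ge0 // sqr_ge0.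
  rewrite !mulrBr !sin2 // (polar_X pq) (polar_beta pq).
  by rewrite -(flow_qa q0 t) (polar_X pt) (polar_beta pt).
- move=> m0 mt b0 bt c.
  have r_ge0 := sqrtr_ge0 (4 * qh q0 ^+ 2 - 1).
  have c0 : 0 < c by rewrite ltr_pwDl // mulr_gt0.
  rewrite (solution_s Jt pq) -/c.
  have yE : qxi (flow_actang q0 t) / 2 = qxi q0 / 2 - 2 * t.
    by rewrite flow_qxi; field.
  (* The branch corrections are m_0 pi at time 0 and (m_0 - m_t) pi at time t; half their difference
     is m_t pi / 2. *)
  rewrite (atan_tan_unwrap c0 b0) -yE (atan_tan_unwrap c0 bt).
  by rewrite intrB; field.
Qed.

End SolutionFormulae.

(** * Global existence for all initial data *)

Section Existence.
Context {R : realType} {d : nat}.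

Lemma polar_action_angle (p : phase R d) : polar_coordinates p (action_angle p).
Proof.
split=> //.
- by move=> i; rewrite mxE.
- exact: xi_cos.
- exact: xi_sin.
- by move=> i; rewrite -theta_cos [qa _ _ _]mxE.
- by move=> i; rewrite -theta_sin [qa _ _ _]mxE.
Qed.

Lemma modulation_existence (A0 k0 B0 : R) (X0 beta0 : 'rV[R]_d) (gamma0 : R) :
  exists (A k B : R -> R) (X beta : R -> 'rV[R]_d) (gamma s : R -> R),
    modulation_solution setT A k B X beta gamma s /\
    [/\ A 0 = A0, k 0 = k0 & B 0 = B0] /\
    [/\ X 0 = X0, beta 0 = beta0 & gamma 0 = gamma0].
Proof.
pose p0 : phase R d := (X0, B0, k0, beta0); pose q0 := action_angle p0.
have pq := polar_action_angle p0; rewrite -/q0 in pq.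
pose h := qh q0; pose x := qxi q0.
have h0 : 0 < h by rewrite /h (polar_h pq) hE_gt0.
have r0 : 0 <= 4 * h ^+ 2 - 1.
  by rewrite /h (polar_h pq) -hypot_h addr_ge0 // sqr_ge0.
pose r := Num.sqrt (4 * h ^+ 2 - 1).
have r2 : r ^+ 2 = 4 * h ^+ 2 - 1 by rewrite sqr_sqrtr.
(* The explicit formulae serve as definitions, with L^2 = [lE] and B = [BE]. As [lE] is positive at
   every time, k is defined on the whole line. *)
pose yE : expr R R := Add (Const x) (Mul (Const (- 4)) (Coord id)).
pose lE : expr R R := Add (Const (2 * h)) (Mul (Const (- r)) (Cos yE)).
pose kE : expr R R := Mul (Const 4^-1) (Ln lE).
pose BE : expr R R := Mul (Const (2 * r)) (Sin yE).
have idc : is_coord (@id R) by move=> u; exact: is_diff_id.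
have yd u : defined yE u by split=> //; split.
have l0 u : 0 < eval lE u.
  by rewrite /= mulNr subr_gt0 mulrC; exact: cos_sqrt_lt.
have kd u : defined kE u by split=> //; split=> //; split.
have Bd u : defined BE u by split.
have l4 u : expR (4 * eval kE u) = eval lE u.
  by rewrite [eval kE u]/= mulVKf ?pnatr_eq0 // lnK // posrE; exact: l0.
have kderiv u : is_derive u (1 : R) (eval kE) (- (eval BE u / (2 * eval lE u))).
  apply: is_derive_eq (is_derive_eval (is_derive_id u 1) (kd u)) _.
  by have := l0 u; rewrite /= => lu; field; rewrite gt_eqF.
have k0E : eval kE 0 = k0.
  rewrite /= mulr0 addr0 mulNr (polar_xcos pq) subKr /= expRK.
  by rewrite mulKf ?pnatr_eq0.
have B0E : eval BE 0 = B0.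
  by rewrite /= mulr0 addr0 -mulrA (polar_xsin pq) /pB /=; field.
pose cE : expr R R := Cos (Mul (Const 2) (Coord id)).
pose sE : expr R R := Sin (Mul (Const 2) (Coord id)).
have cd u : is_derive u (1 : R) (eval cE) (- 2 * eval sE u).
  apply: is_derive_eq (is_derive_eval (is_derive_id u 1) (_ : defined cE u)) _.
    by split.
  by rewrite /=; ring.
have sd u : is_derive u (1 : R) (eval sE) (2 * eval cE u).
  apply: is_derive_eq (is_derive_eval (is_derive_id u 1) (_ : defined sE u)) _.
    by split.
  by rewrite /=; ring.
(* The initial vectors themselves are rotated, so no angle theta_i enters. *)
pose X u : 'rV[R]_d := eval cE u *: X0 + eval sE u *: beta0.
pose beta u : 'rV[R]_d := eval cE u *: beta0 - eval sE u *: X0.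
have c00 : eval cE 0 = 1 by rewrite /= mulr0 cos0.
have s00 : eval sE 0 = 0 by rewrite /= mulr0 sin0.
have cst_d (a u : R) : is_derive u (1 : R) (fun=> a : R) 0.
  exact: is_derive_cst.
have Xd u : is_derive u (1 : R) X (2 *: beta u).
  apply/is_derive_rowP => i.
  under [X in is_derive _ _ X _]funext do rewrite !mxE.
  apply: is_derive_eq (is_derive_fun_add
    (is_derive_fun_mul (cd u) (cst_d (X0 0 i) u))
    (is_derive_fun_mul (sd u) (cst_d (beta0 0 i) u))) _.
  by rewrite !mxE; ring.
have betad u : is_derive u (1 : R) beta (- (2 *: X u)).
  apply/is_derive_rowP => i.
  under [X in is_derive _ _ X _]funext do rewrite !mxE.
  apply: is_derive_eq (is_derive_fun_add
    (is_derive_fun_mul (cd u) (cst_d (beta0 0 i) u))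
    (is_derive_fun_opp (is_derive_fun_mul (sd u) (cst_d (X0 0 i) u)))) _.
  by rewrite !mxE; ring.
pose aE : expr R R :=
  Mul (Const A0) (Exp (Mul (Const (2 - d%:R)) (Add kE (Const (- k0))))).
pose dot u := \sum_i X u 0 i * beta u 0 i.
pose G u := gamma0 + 2^-1 * (dot u + - dot 0).
pose phi u := - 2^-1 * unwrapped_atan_tan (2 * h + r) (x / 2 - 2 * u).
exists (eval aE), (eval kE), (eval BE), X, beta, G, (fun u => phi u + - phi 0).
split; last first.
  split; split=> //.
  - transitivity (A0 * expR ((2 - d%:R) * (eval kE 0 + - k0))) => //.
    by rewrite k0E subrr mulr0 expR0 mulr1.
  - by rewrite /X c00 s00 scale1r scale0r addr0.
  - by rewrite /beta c00 s00 scale1r scale0r subr0.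
  - by rewrite /G subrr mulr0 addr0.
split=> [u _|u _|u _|u _|u _|u _|u _|].
- have ad : defined aE u by split=> //; split=> //; split.
  apply: is_derive_eq (is_derive_eval (is_derive_id u 1) ad) _.
  rewrite sqr_expR2 l4; have := l0 u; rewrite /= => lu.
  by field; rewrite gt_eqF.
- pose eL : expr R R := Exp (Mul (Const 2) (Coord id)).
  have eLd : defined eL (eval kE u) by split.
  apply: is_derive_eq (is_derive_eval (kderiv u) eLd) _.
  rewrite -l4 -sqr_expR2; move: (eval BE u) (eval kE u) => b k.
  rewrite /=; have := expR_gt0 (2 * k).
  by move: (expR _) => L L0; field; rewrite gt_eqF.
- apply: is_derive_eq (is_derive_eval (is_derive_id u 1) (Bd u)) _.
  rewrite sqr_expR2 l4; have := l0 u; rewrite /=.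
  have := cos2Dsin2 (x + -4 * u); move: (cos _) (sin _) => c z cz lu.
  set l := 2 * h + - r * c in lu *.
  (* The circle relation solved for B^2; it reduces the right-hand side of the equation for B to 8
     (l - 2 h) = - 8 r cos (x - 4 u). *)
  have -> : (2 * r * z) ^+ 2 = - 4 + 16 * h * l - 4 * l ^+ 2.
    have z2 : z ^+ 2 = 1 - c ^+ 2 by rewrite -cz addrC addKr.
    by rewrite !exprMn z2 r2 /l; ring: r2.
  transitivity (- 8 * (r * c)); first by ring.
  have -> : r * c = 2 * h - l by rewrite /l; ring.
  by field; rewrite gt_eqF.
- exact: Xd.
- exact: betad.
- have dotd := is_derive_dot (Xd u) (betad u).
  apply: is_derive_eq (is_derive_fun_add (cst_d gamma0 u) (is_derive_fun_mul
    (cst_d 2^-1 u) (is_derive_fun_add dotd (cst_d (- dot 0) u)))) _.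
  rewrite mulr0 add0r !addr0 /sqnorm2 -sumrB mulr_sumr; apply: eq_bigr => i _.
  by rewrite !mxE; field.
- have := is_derive_rescaled_time x u h0 r0.
  rewrite sqr_expR2 l4 => du.
  apply: is_derive_eq (is_derive_fun_add du (cst_d (- phi 0) u)) _.
  rewrite addr0 /= mulNr; congr (_ - _)^-1.
  by rewrite mulrC; congr (_ * cos _); ring.
- by rewrite subrr.
Qed.

End Existence.

Theorem lemma2p2 (R : realType) (d : nat) (hd : (1 <= d)%N) :
  exists Phi : phase R d -> actang R d,
    [/\ symplectic_change nondegenerate_set Phi,
        (* h and a, unlike the angles, make sense at degenerate points too *)
        continuous (fun p => qh (Phi p)) /\ continuous (fun p => qa (Phi p)),
        forall p, hamiltonian p = new_hamiltonian (Phi p),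
        (* every initial datum has a global solution *)
        forall (A0 k0 B0 : R) (X0 beta0 : 'rV[R]_d) (gamma0 : R),
          exists (A k B : R -> R) (X beta : R -> 'rV[R]_d) (gamma s : R -> R),
            modulation_solution setT A k B X beta gamma s /\
            [/\ A 0 = A0, k 0 = k0 & B 0 = B0] /\
            [/\ X 0 = X0, beta 0 = beta0 & gamma 0 = gamma0] &
        (* every solution is given by the flow and the explicit formulae *)
        forall (J : set R) (A k B : R -> R) (X beta : R -> 'rV[R]_d)
            (gamma s : R -> R),
          open J -> is_interval J -> J 0 ->
          modulation_solution J A k B X beta gamma s ->
          let p := fun t => (X t, B t, k t, beta t) : phase R d in
          forall q0 : actang R d, coordinates_of Phi (p 0) q0 ->
          forall t, J t ->
            [/\ nondegenerate_set (p 0) -> nondegenerate_set (p t),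
                coordinates_of Phi (p t) (flow_actang q0 t) &
                explicit_formulae q0 t A k B X beta gamma s]].
Proof.
exists action_angle; split.
- exact: symplectic_action_angle.
- by split; [exact: continuous_action_h|exact: continuous_action_a].
- exact: hamiltonian_action_angle.
- exact: modulation_existence.
move=> J A k B X beta gamma s _ iJ J0 sol p q0 /coordinates_ofP pq t Jt; split.
- exact: (solution_nondegenerate iJ J0 sol Jt).
- exact/coordinates_ofP/(solution_polar iJ J0 sol).
- exact: (solution_explicit iJ J0 sol).
Qed.
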